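(* Let $(G,\boldsymbol{\gamma})$ be a $\mathbb{Z}/2\mathbb{Z}$-colored graph with symmetric lift $(\tilde G,\varphi)$. A generic realization of a reflection framework with underlying symmetric graph $(\tilde G,\varphi)$ is minimally rigid if and only if $(G,\boldsymbol{\gamma})$ is a reflection-Laman graph.
   Context: A colored graph $(G,\boldsymbol{\gamma})$ is a finite directed multigraph $G=(V,E)$ (self-loops and parallel edges allowed) with a color $\gamma_{ij}\in\mathbb{Z}/2\mathbb{Z}$ on each edge $ij$. The map $\rho:H_1(G,\mathbb{Z})\to\mathbb{Z}/2\mathbb{Z}$ is the homomorphism sending a cycle to the sum of the colors of its edges; the $\rho$-image of a subgraph is the image under $\rho$ of its cycles, called trivial if it is $\{0\}$. For a subgraph $G'$ let $n',m'$ be its numbers of vertices and edges, $c'$ the number of its connected components with non-trivial $\rho$-image and $c'_0$ the number with trivial $\rho$-image. $(G,\boldsymbol{\gamma})$ with $n$ vertices and $m$ edges is reflection-Laman if $m=2n-1$ and every subgraph satisfies $m'\le 2n'-c'-3c'_0$. The symmetric lift $(\tilde G,\varphi)$ has vertices $\tilde i_\gamma$ ($i\in V$, $\gamma\in\mathbb{Z}/2\mathbb{Z}$), and for each edge $ij$ the two edges $\tilde i_\gamma\tilde j_{\gamma+\gamma_{ij}}$; the non-trivial element of $\mathbb{Z}/2\mathbb{Z}$ acts by $\varphi:\tilde i_\gamma\mapsto\tilde i_{\gamma+1}$ (freely on vertices and edges). A reflection framework is $(\tilde G,\varphi,\boldsymbol{\ell})$ with edge lengths $\ell_{ij}\ge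 0$. A realization is a pair $(\vec p,\Phi)$, where $\Phi$ is a representation of $\mathbb{Z}/2\mathbb{Z}$ in $\mathrm{Euc}(2)$ by a reflection and $\vec p=(\vec p_v)_{v\in V(\tilde G)}$ are points of $\mathbb{R}^2$, with $\|\vec p_w-\vec p_v\|=\ell_{vw}$ for every edge $vw$ of $\tilde G$ and $\vec p_{\varphi(\gamma)\cdot v}=\Phi(\gamma)\cdot\vec p_v$ for all $\gamma,v$. The configuration space is the set of realizations modulo the action of $\mathrm{Euc}(2)$; a realization is rigid if it is isolated in the configuration space and flexible otherwise. A realization is minimally rigid if it is rigid and, for every edge of $G$, removing the corresponding fiber of two edges from $\tilde G$ (keeping the same points and lengths) gives a flexible realization. Generic means: the realization (the point coordinates) lies outside some proper algebraic subset, depending only on $(G,\boldsymbol{\gamma})$, of the space of symmetric point configurations. *)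

(* Defs.v *)
From HB Require Import structures.
From mathcomp Require Import all_boot all_order all_algebra.
From mathcomp Require Import boolp reals.
From mathcomp Require mpoly.

Set Implicit Arguments.
Unset Strict Implicit.
Unset Printing Implicit Defensive.
Import Order.TTheory GRing.Theory Num.Theory.
Local Open Scope ring_scope.

Section ColoredGraph.
Variables (V E : finType) (src tgt : E -> V) (gam : E -> 'Z_2).

(* 1-cycles of the graph supported on the edge set S: integer edge
   weightings with zero boundary (H_1(G,Z) = Z_1, no 2-cells). *)
Definition is_cycle (S : {set E}) (z : E -> int) : Prop :=
  (forall e, e \notin S -> z e = 0) /\
  (forall v : V, \sum_(e | tgt e == v) z e - \sum_(e | src e == v) z e = 0).

Definition rho (z : E -> int) : 'Z_2 := \sum_e (z e)%:~R * gam e.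

Definition trivial_rho (S : {set E}) : Prop :=
  forall z, is_cycle S z -> rho z = 0.

Definition VF (F : {set E}) : {set V} :=
  [set v | [exists e in F, (src e == v) || (tgt e == v)]].

Definition adjF (F : {set E}) : rel V :=
  fun x y => [exists e in F, ((src e == x) && (tgt e == y)) ||
                             ((src e == y) && (tgt e == x))].

Definition comps (F : {set E}) : {set {set V}} :=
  [set [set y | connect (adjF F) x y] | x in VF F].

Definition compE (F : {set E}) (C : {set V}) : {set E} :=
  [set e in F | src e \in C].

Definition c_nontriv (F : {set E}) : nat :=
  #|[set C in comps F | `[< ~ trivial_rho (compE F C) >]]|.
Definition c_triv (F : {set E}) : nat :=
  #|[set C in comps F | `[< trivial_rho (compE F C) >]]|.

Definition reflection_laman : Prop :=
  (#|E|%:Z = 2 * #|V|%:Z - 1) /\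
  forall F : {set E},
    #|F|%:Z <= 2 * #|VF F|%:Z - (c_nontriv F)%:Z - 3 * (c_triv F)%:Z.

Variable R : realType.

Definition pt := 'rV[R]_2.
Definition dot (x y : pt) : R := (x *m y^T) 0 0.
Definition norm (x : pt) : R := Num.sqrt (dot x x).

(* vertices of the symmetric lift: (i, gamma) ; phi : (i,g) |-> (i, g+1);
   the lift of edge e consists of the edges (src e, g) -- (tgt e, g + gam e). *)
Definition liftV := (V * 'Z_2)%type.
Definition phi (v : liftV) : liftV := (v.1, v.2 + 1).

Definition aff (A : 'M[R]_2) (b : pt) (x : pt) : pt := x *m A + b.

(* (A,b) is the reflection in the line {x | x.u = c}, |u| = 1:
   x |-> x - 2 ((x.u) - c) u *)
Definition is_reflection (A : 'M[R]_2) (b : pt) : Prop :=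
  exists (u : pt) (c : R), dot u u = 1 /\
    A = 1%:M - 2 *: (u^T *m u) /\ b = (2 * c) *: u.

Definition is_euc (Q : 'M[R]_2) : Prop := Q *m Q^T = 1%:M.

(* p is symmetric w.r.t. the representation Phi (Phi(1) = aff A b) *)
Definition is_symmetric (p : liftV -> pt) (A : 'M[R]_2) (b : pt) : Prop :=
  forall v, p (phi v) = aff A b (p v).

Definition realization (F : {set E}) (p : liftV -> pt)
  (q : liftV -> pt) (A : 'M[R]_2) (b : pt) : Prop :=
  is_reflection A b /\ is_symmetric q A b /\
  forall e, e \in F -> forall g : 'Z_2,
    norm (q (tgt e, g + gam e) - q (src e, g)) =
    norm (p (tgt e, g + gam e) - p (src e, g)).

Definition congruent (p : liftV -> pt) (A : 'M[R]_2) (b : pt)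
  (q : liftV -> pt) (A' : 'M[R]_2) (b' : pt) : Prop :=
  exists (Q : 'M[R]_2) (t : pt), is_euc Q /\
    (forall v, q v = aff Q t (p v)) /\
    (forall x, aff Q t (aff A b x) = aff A' b' (aff Q t x)).

(* rigid: isolated in the configuration space (realizations modulo Euc(2)),
   i.e. every realization near (p, Phi) is congruent to it *)
Definition rigid (F : {set E}) (p : liftV -> pt) (A : 'M[R]_2) (b : pt) : Prop :=
  exists eps : R, 0 < eps /\
    forall q A' b', realization F p q A' b' ->
      (forall v, norm (q v - p v) < eps) ->
      (forall i j, `|A' i j - A i j| < eps) ->
      norm (b' - b) < eps ->
      congruent p A b q A' b'.

Definition minimally_rigid (p : liftV -> pt) (A : 'M[R]_2) (b : pt) : Prop :=
  rigid setT p A b /\ forall e : E, ~ rigid (setT :\ e) p A b.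

Definition NC := #|{: liftV * 'I_2}|.
Definition coords (p : liftV -> pt) : 'I_NC -> R :=
  fun k => let: (v, i) := enum_val k in p v 0 i.

Definition symmetric_config (p : liftV -> pt) : Prop :=
  exists A b, is_reflection A b /\ is_symmetric p A b.

End ColoredGraph.

(* Main.v *)
Require Import Defs.
From HB Require Import structures.
From mathcomp Require Import all_boot all_order all_algebra.
From mathcomp Require Import ring lra zify.
From mathcomp Require Import boolp reals.
From mathcomp Require interval_inference classical_sets functions topology.
From mathcomp Require normedtype sequences.
From mathcomp Require mpoly.

Set Implicit Arguments.
Unset Strict Implicit.
Unset Printing Implicit Defensive.
Import Order.TTheory GRing.Theory Num.Theory.
Local Open Scope ring_scope.

(** In coordinates adapted to the mirror a symmetric configuration is a vector z in R^(2n),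
    and the edge ij of color g has squared length (x_j - x_i)^2 + (y_j - (-1)^g y_i)^2. The
    only trivial motion is the translation along the mirror, so that the rank of the rigidity
    matrix is at most 2n - 1. Since the lengths are quadratic forms, the difference of the
    lengths at two configurations is given by the rigidity matrix at their midpoint. Hence
    2n - 1 independent edges are rigid; if the rank is maximal and smaller than 2n - 1, a
    contraction argument gives a nontrivial motion that preserves the lengths of a maximal
    independent set, hence those of the edges that depend on it.

    Generic independence is sparsity. Translations and, on balanced subgraphs (those with
    trivial rho-image, that is, where the color is a coboundary), the motions of an
    unconstrained plane framework give the necessary counts. Conversely a sparse graph has a
    vertex of degree at most three and is reduced by inverse Henneberg moves; at a vertex of
    degree three, counting the tight subgraphs that block the three possible new edges shows
    that they cannot all exist. *)

(** * Independent families of rows *)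

(** Everything turns on one edge set [F0], of largest cardinality among the sets that are
    independent at some configuration; the exceptional polynomial only expresses that this set is
    independent at [p]. Since the maximum runs over all configurations, [e |: F0] is dependent
    everywhere, in particular at the midpoint of two configurations with equal lengths on [F0];
    hence the length of [e] is preserved exactly, without a constant-rank theorem. Both implications
    then reduce to [F0 = setT] and the count [2n - 1]. Two obstacles shape the rest. The mirror is
    part of a realization and may move, so a nearby realization must be read in the coordinates of
    its own mirror, and the polynomial must serve all mirrors although it sees only point
    coordinates. In the blocker counts, potentials of two balanced blockers may agree at one common
    vertex and disagree at another, and then their union is not balanced; the two cases are counted
    separately. *)

Definition indep (K : fieldType) (E S : finType) (M : E -> S -> K) (F : {set E}) :=
  forall w : E -> K, (forall k, \sum_(e in F) w e * M e k = 0) ->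
    forall e, e \in F -> w e = 0.

Section LinearAlgebra.
Variables (K : fieldType) (E S : finType).
Implicit Types (M : E -> S -> K) (F : {set E}).

Definition rows M F : 'M[K]_(#|F|, #|S|) := \matrix_(i, j) M (enum_val i) (enum_val j).

Lemma row_free_rows M F : indep M F -> row_free (rows M F).
Proof.
move=> hF; apply: inj_row_free => v hv; apply/rowP => i; rewrite mxE.
(* The match on [=P] hands over the membership proof that [enum_rank_in] takes; 0 outside [F] is a
   default. *)
pose w e := if e \in F =P true is ReflectT h then v 0 (enum_rank_in h e) else 0.
have wE j : w (enum_val j) = v 0 j.
  rewrite /w; case: eqP => [h|/negP]; last by rewrite enum_valP.
  by rewrite enum_valK_in.
rewrite -wE; apply: hF; last exact: enum_valP.
move=> k; rewrite big_enum_val /=.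
move/rowP/(_ (enum_rank k)): hv; rewrite !mxE => h; rewrite -[RHS]h.
by apply: eq_bigr => j _; rewrite wE mxE enum_rankK.
Qed.

(** Full row rank gives a right inverse. [W] turns independence into estimates, into the correction
    term of a flex, and into the genericity polynomial. *)
Lemma indep_rinv M F : indep M F ->
  exists W : S -> E -> K, forall e e', e \in F -> e' \in F ->
    \sum_k M e k * W k e' = (e == e')%:R.
Proof.
move=> /row_free_rows /row_freeP [B hB].
exists (fun k e => if e \in F =P true is ReflectT h
                   then B (enum_rank k) (enum_rank_in h e) else 0) => e e' he he'.
case: eqP => // h.
move/matrixP/(_ (enum_rank_in he e) (enum_rank_in h e')): hB.
have -> : (e == e') = (enum_rank_in he e == enum_rank_in h e').
  apply/eqP/eqP => [ee|]; first by apply/enum_val_inj; rewrite !enum_rankK_in.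
  by move/(congr1 enum_val); rewrite !enum_rankK_in.
rewrite !mxE => <-; rewrite [RHS](reindex (@enum_rank S)); last exact/onW_bij/enum_rank_bij.
by apply: eq_bigr => k _; rewrite !mxE enum_rankK enum_rankK_in.
Qed.

Lemma indep_sub M (F F' : {set E}) : F' \subset F -> indep M F -> indep M F'.
Proof.
move=> sF hF w hw e he.
have := hF (fun e => if e \in F' then w e else 0) _ e (subsetP sF _ he).
rewrite he; apply => k; rewrite -[RHS](hw k) big_mkcond [RHS]big_mkcond /=.
apply: eq_bigr => f _; case: (boolP (f \in F')) => hf; last by rewrite mul0r if_same.
by rewrite (subsetP sF _ hf).
Qed.

(** The vectors [N g] lie in the kernel of the rows, so the two ranks add up to at most the number
    of columns. This is the source of the Maxwell counts. *)
Lemma indep_orth_card (G : finType) M (N : G -> S -> K) F :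
  indep M F -> indep N [set: G] ->
  (forall e g, e \in F -> \sum_k M e k * N g k = 0) -> (#|F| + #|G| <= #|S|)%N.
Proof.
move=> /row_free_rows hM hN hMN.
pose B : 'M[K]_(#|G|, #|S|) := \matrix_(i, j) N (enum_val i) (enum_val j).
have hB : row_free B.
  apply: inj_row_free => v hv; apply/rowP => i; rewrite mxE.
  have := hN (fun g => v 0 (enum_rank g)) _ (enum_val i) (in_setT _).
  rewrite enum_valK; apply => k.
  rewrite (eq_bigl predT) => [|g]; last by rewrite inE.
  move/rowP/(_ (enum_rank k)): hv; rewrite !mxE => h; rewrite -[RHS]h.
  rewrite [RHS](reindex (@enum_rank G)); last exact/onW_bij/enum_rank_bij.
  by apply: eq_bigr => g _; rewrite !mxE !enum_rankK.
have := @mulmx0_rank_max _ _ _ _ (rows M F) B^T; rewrite mxrank_tr.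
move: hM hB; rewrite /row_free => /eqP -> /eqP ->; apply.
apply/matrixP => i j; rewrite !mxE -[RHS](hMN (enum_val i) (enum_val j)) ?enum_valP //.
rewrite [RHS](reindex (@enum_val S predT)); last exact/onW_bij/enum_val_bij.
by apply: eq_bigr => k _; rewrite !mxE.
Qed.

Lemma exists_kernel_vector M F : (#|F| < #|S|)%N ->
  exists2 d : S -> K, exists k, d k != 0 & forall e, e \in F -> \sum_k M e k * d k = 0.
Proof.
move=> ltFS; pose C := kermx (rows M F)^T.
have : C != 0.
  rewrite kermx_eq0 /row_free mxrank_tr; apply: contraTneq ltFS => <-.
  by rewrite -leqNgt rank_leq_row.
case/matrix0Pn => i [j hij].
exists (fun k => C i (enum_rank k)) => [|e he].
  by exists (enum_val j); rewrite enum_valK.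
have /matrixP/(_ i (enum_rank_in he e)) : C *m (rows M F)^T = 0 by exact: mulmx_ker.
rewrite !mxE => h; rewrite -[RHS]h [RHS](reindex (@enum_rank S)); last exact/onW_bij/enum_rank_bij.
by apply: eq_bigr => k _; rewrite !mxE enum_rankK enum_rankK_in // mulrC.
Qed.

Lemma max_indep_span M F e : indep M F -> ~ indep M (e |: F) ->
  exists c : E -> K, forall k, M e k = \sum_(f in F) c f * M f k.
Proof.
move=> hF hn; have heF : e \notin F.
  by apply/negP => he; apply: hn; rewrite (setUidPr _) // sub1set.
have [w [hw [f hf hwf]]] : exists w : E -> K,
    (forall k, \sum_(f in e |: F) w f * M f k = 0) /\ exists2 f, f \in e |: F & w f != 0.
  apply: contrapT => h; apply: hn => w hw f hf; apply/eqP/negPn/negP => hwf.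
  by apply: h; exists w; split=> //; exists f.
have hs k : w e * M e k + \sum_(f in F) w f * M f k = 0.
  by rewrite -[RHS](hw k) big_setU1.
have hwe : w e != 0.
  apply: contraNneq hwf => we0; move: hf; rewrite in_setU1 => /predU1P [->|hf].
    by rewrite we0.
  by apply/eqP; apply: (hF w) => // k; rewrite -[RHS](hs k) we0 mul0r add0r.
exists (fun f => - (w f / w e)) => k.
apply: (mulfI hwe); rewrite mulr_sumr (eq_bigr (fun f => - (w f * M f k))).
  by rewrite sumrN; apply/eqP; rewrite -addr_eq0 hs.
by move=> g _; field.
Qed.

End LinearAlgebra.

(** * Small solutions of quadratic systems *)

Section FixedPoint.
Import interval_inference classical_sets functions topology normedtype sequences.
Variables (R : realType) (S : finType).

HB.instance Definition _ n := Complete.on 'rV[R]_n.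

Lemma mx_norm_le n (x : 'rV[R]_n) (c : R) : 0 <= c ->
  (forall i, `|x 0 i| <= c) -> `|x| <= c.
Proof.
move=> c0 h; rewrite /Num.norm /= mx_normrE; apply/bigmax_leP; split=> // -[i j] _ /=.
by rewrite ord1.
Qed.

Lemma le_mx_norm n (x : 'rV[R]_n) i : `|x 0 i| <= `|x|.
Proof.
by rewrite [leRHS]/Num.norm /= mx_normrE; apply/bigmax_geP; right => /=; exists (0, i).
Qed.

Lemma half_contraction_fixed_point (r : R) (f : (S -> R) -> S -> R) : 0 <= r ->
  (forall d, (forall k, `|d k| <= r) -> forall k, `|f d k| <= r) ->
  (forall d d' (c : R), (forall k, `|d k| <= r) -> (forall k, `|d' k| <= r) -> 0 <= c ->
     (forall k, `|d k - d' k| <= c) -> forall k, `|f d k - f d' k| <= 2^-1 * c) ->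
  exists2 d, (forall k, `|d k| <= r) & forall k, d k = f d k.
Proof.
move=> r0 hf hL; pose T : completeNormedModType R := 'rV[R]_#|S|.
pose v (x : T) : S -> R := fun k => x 0 (enum_rank k).
pose g (x : T) : T := \row_i f (v x) (enum_val i).
pose U : set T := closed_ball_ Num.norm (0 : T) r.
have UE x : U x -> forall k, `|v x k| <= r.
  rewrite /U /closed_ball_ /= sub0r normrN => h k.
  exact: (le_trans (le_mx_norm _ _)).
have gU : set_fun U U g.
  move=> x /UE Ux; rewrite /U /closed_ball_ /= sub0r normrN.
  by apply: mx_norm_le => // i; rewrite mxE; exact: hf.
pose fb := isFun.Build _ _ U U g gU.
pose G : {fun U >-> U} := HB.pack g fb.
have hG : is_contraction G.
  exists (2^-1%:nng); split => /=; first by lra.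
  move=> [x y] [/= /UE Ux /UE Uy]; apply: mx_norm_le => [|i].
    by rewrite mulr_ge0.
  rewrite !mxE; apply: hL => // k; have := le_mx_norm (x - y) (enum_rank k).
  by rewrite !mxE.
have [||x Ux xE] := banach_fixed_point hG.
- exact: closed_closed_ball_.
- by exists 0; rewrite /U /closed_ball_ /= subrr normr0.
exists (v x); first exact: UE.
by move=> k; rewrite {1}/v [in LHS]xE mxE enum_rankK.
Qed.

(** For small [t] the right-hand side is a half contraction of a small ball. In the application [u]
    is an infinitesimal motion and the quadratic term corrects the lengths exactly, in place of the
    implicit function theorem. *)
Lemma small_quadratic_solution (u : S -> R) (b : S -> S -> S -> R) (eps : R) :
  0 < eps -> (exists k, u k != 0) ->
  exists t, exists2 d : S -> R, (exists k, d k != 0) /\ (forall k, `|d k| < eps) &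
    forall k, d k = t * u k + \sum_i \sum_j b k i j * (d i * d j).
Proof.
move=> eps0 [k1 hk1].
pose C := 1 + \sum_k \sum_i \sum_j `|b k i j|.
pose D := 1 + \sum_k `|u k|.
have hC k : \sum_i \sum_j `|b k i j| <= C.
  rewrite /C (bigD1 (P := predT) (F := fun k => \sum_i \sum_j `|b k i j|) k) //=.
  rewrite addrCA lerDl addr_ge0 // sumr_ge0 // => i _.
  by rewrite sumr_ge0 // => j _; rewrite sumr_ge0.
have hD k : `|u k| <= D.
  by rewrite /D (bigD1 k) //= addrCA lerDl addr_ge0 // sumr_ge0.
have C1 : 1 <= C.
  by rewrite lerDl sumr_ge0 // => i _; rewrite sumr_ge0 // => j _; rewrite sumr_ge0.
have D1 : 1 <= D by rewrite lerDl sumr_ge0.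
(* [C * r <= 1/4] makes the quadratic part Lipschitz with constant [2 * C * r <= 1/2] and bounds it
   by [r / 4]; the choice of [t] keeps the linear part below [r / 2]. *)
pose r := Num.min (eps / 2) (4 * C)^-1.
have r0 : 0 < r by rewrite lt_min divr_gt0 ?invr_gt0 //=; lra.
have reps : r < eps.
  by have := ge_min (eps / 2) (eps / 2) (4 * C)^-1; rewrite lexx /= -/r => h; lra.
have rC : C * r <= 4^-1.
  have : r <= (4 * C)^-1 by rewrite ge_min lexx orbT.
  rewrite -(ler_pM2l (_ : 0 < C)); last by lra.
  by rewrite invfM mulrCA divff ?mulr1 // gt_eqF //; lra.
pose t := r / (2 * D).
have t0 : t != 0 by rewrite mulf_neq0 ?invr_eq0 ?gt_eqF //; lra.
have htu k : `|t * u k| <= r / 2.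
  rewrite normrM ger0_norm; last by rewrite divr_ge0 //; lra.
  have -> : r / 2 = t * D by rewrite /t; field; lra.
  by rewrite ler_wpM2l // divr_ge0 //; lra.
pose q (d : S -> R) k := \sum_i \sum_j b k i j * (d i * d j).
have bound (e : S -> S -> R) c k : (forall i j, `|e i j| <= c) -> 0 <= c ->
    `|\sum_i \sum_j b k i j * e i j| <= C * c.
  move=> he c0; apply: le_trans (ler_wpM2r c0 (hC k)).
  rewrite mulr_suml; apply: le_trans (ler_norm_sum _ _ _) _; apply: ler_sum => i _.
  rewrite mulr_suml; apply: le_trans (ler_norm_sum _ _ _) _; apply: ler_sum => j _.
  by rewrite normrM ler_wpM2l.
pose f (d : S -> R) k := t * u k + q d k.
have [|d hd k|d d' c hd hd' c0 hdd k|d hd fd] := @half_contraction_fixed_point r f.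
- exact: ltW.
- apply: le_trans (ler_normD _ _) _.
  have := htu k; have : `|q d k| <= C * (r * r).
    by apply: bound => [i j|]; rewrite ?normrM ?ler_pM // mulr_ge0 // ltW.
  have : C * (r * r) <= 4^-1 * r by rewrite mulrA ler_wpM2r // ltW.
  lra.
- rewrite /f opprD addrACA subrr add0r -sumrB.
  under eq_bigr => i _ do [rewrite -sumrB; under eq_bigr => j _ do rewrite -mulrBr].
  apply: le_trans (bound _ (2 * r * c) k _ _) _.
  + move=> i j; have -> : d i * d j - d' i * d' j = d i * (d j - d' j) + (d i - d' i) * d' j by ring.
    apply: le_trans (ler_normD _ _) _; rewrite !normrM.
    have : `|d i| * `|d j - d' j| <= r * c by rewrite ler_pM.
    have : `|d i - d' i| * `|d' j| <= c * r by rewrite ler_pM.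
    lra.
  + by rewrite !mulr_ge0 // ltW.
  + have -> : C * (2 * r * c) = 2 * (C * r) * c by ring.
    by rewrite ler_wpM2r //; lra.
- exists t, d => //; split; last by move=> k; exact: le_lt_trans (hd k) reps.
  (* The zero vector is no fixed point: its image is [t * u]. *)
  apply: contrapT => hn; have d0 k : d k = 0.
    by apply/eqP/negPn/negP => hk; apply: hn; exists k.
  have := fd k1; rewrite d0 /f /q big1 => [|i _]; last first.
    by rewrite big1 // => j _; rewrite d0 mul0r mulr0.
  by move/esym/eqP; rewrite addr0 mulf_eq0 (negbTE t0) (negbTE hk1).
Qed.

End FixedPoint.

(** * Rigidity in mirror-adapted coordinates *)

(** A relation [w] among perturbed rows, multiplied by the right inverse of the old ones, gives
    [sum |w| <= eps * C * sum |w|] with [eps * C <= 1/2], hence [w = 0]. *)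
Lemma indep_open (R : realFieldType) (E S : finType) (M : E -> S -> R) (F : {set E}) :
  indep M F -> exists2 eps : R, 0 < eps &
    forall M', (forall e k, e \in F -> `|M' e k - M e k| < eps) -> indep M' F.
Proof.
move=> /indep_rinv [W hW].
pose C := \sum_(f in F) \sum_k `|W k f|.
have C0 : 0 <= C by rewrite sumr_ge0 // => f _; rewrite sumr_ge0.
exists (2 * (C + 1))^-1; first by rewrite invr_gt0; lra.
set eps := _^-1 => M' hM w hw.
have eps0 : 0 < eps by rewrite invr_gt0; lra.
have epsC : eps * C <= 2^-1.
  have -> : 2^-1 = eps * (C + 1) by rewrite /eps; field; lra.
  by rewrite ler_pM2l //; lra.
pose s := \sum_(e in F) `|w e|.
have hwf f : f \in F -> w f = - \sum_k \sum_(e in F) w e * (M' e k - M e k) * W k f.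
  move=> hf.
  have -> : w f = \sum_k \sum_(e in F) w e * M e k * W k f.
    rewrite exchange_big /= (bigD1 f) //= [X in _ + X]big1 => [|e /andP[he hef]].
      rewrite addr0; under eq_bigr => k _ do rewrite -mulrA.
      by rewrite -mulr_sumr hW // eqxx mulr1.
    under eq_bigr => k _ do rewrite -mulrA.
    by rewrite -mulr_sumr hW // (negbTE hef) mulr0.
  rewrite -sumrN; apply: eq_bigr => k _; apply/eqP; rewrite -subr_eq0 opprK; apply/eqP.
  rewrite -big_split /=; under eq_bigr => e _ do rewrite -mulrDl -mulrDr addrC subrK.
  by rewrite -mulr_suml hw mul0r.
have hs : s <= s * (eps * C).
  rewrite mulrA /C mulr_sumr; apply: ler_sum => f hf; rewrite {1}hwf // normrN.
  apply: le_trans (ler_norm_sum _ _ _) _; rewrite mulr_sumr; apply: ler_sum => k _.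
  apply: le_trans (ler_norm_sum _ _ _) _; rewrite mulr_suml mulr_suml.
  apply: ler_sum => e he; rewrite !normrM ler_wpM2r // ler_wpM2l //.
  exact/ltW/hM.
have s0 : 0 <= s by rewrite sumr_ge0.
have /eqP : s = 0.
  have := ler_wpM2l s0 epsC; lra.
rewrite psumr_eq0 // => /allP h e he.
by have := h e (mem_index_enum e); rewrite he normr_eq0 => /eqP.
Qed.

(** Otherwise [translation] and [d] would be two independent vectors orthogonal to at least
    [#|S| - 1] independent rows. *)
Lemma corank1_kernel (K : fieldType) (E S : finType) (M : E -> S -> K) (F : {set E})
    (translation d : S -> K) :
  indep M F -> (#|S| <= #|F|.+1)%N ->
  (forall e, e \in F -> \sum_k M e k * translation k = 0) ->
  (forall e, e \in F -> \sum_k M e k * d k = 0) ->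
  (exists k, translation k != 0) -> exists c, forall k, d k = c * translation k.
Proof.
move=> hF hcard htau hd [k0 hk0]; apply: contrapT => hn.
pose N (b : bool) := if b then d else translation.
have := @indep_orth_card K E S bool M N F hF; rewrite card_bool => h.
suff : (#|F| + 2 <= #|S|)%N by rewrite leqNgt addn2 ltnS hcard.
apply: h => [w hw e _|e [] he]; [|exact: hd|exact: htau].
have hw' k : w true * d k + w false * translation k = 0.
  by rewrite -[RHS](hw k) (eq_bigl predT) ?big_bool // => i; rewrite inE.
have wt : w true = 0.
  apply/eqP/negPn/negP => h1; apply: hn; exists (- (w false / w true)) => k.
  apply: (mulfI h1); have /eqP := hw' k; rewrite addr_eq0 => /eqP ->; field.
  exact: h1.
case: e => //; apply/eqP; have /eqP := hw' k0.
by rewrite wt mul0r add0r mulf_eq0 (negbTE hk0) orbF.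
Qed.

Section ReducedFramework.
Variables (R : realType) (V E : finType) (src tgt : E -> V) (gam : E -> 'Z_2).
Implicit Types (z d m : V * bool -> R) (e : E) (F : {set E}) (b : bool).

Definition sg (c : 'Z_2) : R := (-1) ^+ (c : nat).

(* In coordinates adapted to the mirror, (v, false) is the coordinate of the vertex v
   along the mirror and (v, true) its signed distance to the mirror; an edge of color 1
   joins v to the mirror image of w, whence the sign. *)
Definition sgb (c : 'Z_2) b : R := if b then sg c else 1.

Definition del z e b : R := z (tgt e, b) - sgb (gam e) b * z (src e, b).

Definition len z e : R := \sum_b del z e b ^+ 2.

Lemma lenE z e : len z e = (z (tgt e, true) - sg (gam e) * z (src e, true)) ^+ 2 +
  (z (tgt e, false) - z (src e, false)) ^+ 2.
Proof. by rewrite /len big_bool /del /= mul1r. Qed.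

Definition dcoef e b (k : V * bool) : R :=
  (k == (tgt e, b))%:R - sgb (gam e) b * (k == (src e, b))%:R.

(** Half of the gradient of [len _ e] at [z]. *)
Definition rig_row z e (k : V * bool) : R := \sum_b del z e b * dcoef e b k.

Lemma sum_delta (T : finType) (f : T -> R) (x : T) : \sum_k (k == x)%:R * f k = f x.
Proof.
rewrite (bigD1 x) //= eqxx mul1r big1 ?addr0 // => k /negbTE ->.
by rewrite mul0r.
Qed.

Lemma del_sum z e b : del z e b = \sum_k dcoef e b k * z k.
Proof.
under eq_bigr => k _ do rewrite mulrBl -mulrA.
by rewrite sumrB -mulr_sumr !sum_delta.
Qed.

Lemma row_dot m d e : \sum_k rig_row m e k * d k = \sum_b del m e b * del d e b.
Proof.
under eq_bigr => k _ do rewrite mulr_suml.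
rewrite exchange_big; apply: eq_bigr => b _; rewrite (del_sum d) mulr_sumr.
by apply: eq_bigr => k _; rewrite mulrA.
Qed.

Lemma delD z z' e b : del (fun k => z k + z' k) e b = del z e b + del z' e b.
Proof. by rewrite /del; ring. Qed.

Lemma delB z z' e b : del (fun k => z k - z' k) e b = del z e b - del z' e b.
Proof. by rewrite /del; ring. Qed.

Lemma delZ (a : R) z e b : del (fun k => a * z k) e b = a * del z e b.
Proof. by rewrite /del; ring. Qed.

(* An exact identity: a change of lengths from z to z' is governed by the rigidity matrix at
   the midpoint, so no linearization error appears. *)
Lemma len_diff z z' e :
  len z' e - len z e = \sum_k rig_row (fun k => z k + z' k) e k * (z' k - z k).
Proof.
rewrite row_dot /len -sumrB; apply: eq_bigr => b _; rewrite delD delB; ring.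
Qed.

Lemma rowZ (a : R) z e k : rig_row (fun k => a * z k) e k = a * rig_row z e k.
Proof. by rewrite /rig_row mulr_sumr; apply: eq_bigr => b _; rewrite delZ mulrA. Qed.

Lemma indep_rowZ (a : R) z F : a != 0 ->
  indep (rig_row z) F -> indep (rig_row (fun k => a * z k)) F.
Proof.
move=> a0 hF w hw; apply: hF => k; apply: (mulfI a0).
rewrite mulr0 -[RHS](hw k) mulr_sumr; apply: eq_bigr => e _; rewrite rowZ; ring.
Qed.

Lemma normr_sgb c b : `|sgb c b| = 1.
Proof. by case: b; rewrite /= ?normr1 // normrX normrN1 expr1n. Qed.

Lemma row_close z z' (eps : R) : (forall k, `|z' k - z k| <= eps) ->
  forall e k, `|rig_row z' e k - rig_row z e k| <= 8 * eps.
Proof.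
move=> h e k; rewrite /rig_row -sumrB.
apply: le_trans (ler_norm_sum _ _ _) _.
have hb b : `|del z' e b * dcoef e b k - del z e b * dcoef e b k| <= 4 * eps.
  rewrite -mulrBl -delB normrM.
  have h1 : `|del (fun k => z' k - z k) e b| <= 2 * eps.
    apply: le_trans (ler_normB _ _) _; rewrite normrM normr_sgb.
    by have := h (tgt e, b); have := h (src e, b); lra.
  have h2 : `|dcoef e b k| <= 2.
    apply: le_trans (ler_normB _ _) _; rewrite normrM normr_sgb.
    by do 2!case: (_ == _); rewrite ?normr1 ?normr0; lra.
  have := ler_pM (normr_ge0 _) (normr_ge0 _) h1 h2; lra.
rewrite big_bool /=; have := hb true; have := hb false; lra.
Qed.

Lemma indep_row_open z F : indep (rig_row z) F -> exists2 eps : R, 0 < eps &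
  forall z', (forall k, `|z' k - z k| < eps) -> indep (rig_row z') F.
Proof.
move=> /indep_open [eps eps0 h]; exists (eps / 9); first by lra.
move=> z' hz; apply: h => e k _.
have := @row_close z z' (eps / 9) (fun k => ltW (hz k)) e k; lra.
Qed.

Definition translation (k : V * bool) : R := (~~ k.2)%:R.

Lemma row_translation z e : \sum_k rig_row z e k * translation k = 0.
Proof.
by rewrite row_dot big1 // => -[] _; rewrite /del /translation /= ?mulr0 ?mulr1 subrr mulr0.
Qed.

Lemma reduced_rigid (v0 : V) z F : indep (rig_row z) F -> #|F|.+1 = (2 * #|V|)%N ->
  exists2 eps : R, 0 < eps & forall z', (forall k, `|z' k - z k| < eps) ->
    (forall e, e \in F -> len z' e = len z e) ->
    exists c, forall k, z' k = z k + c * translation k.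
Proof.
move=> hF hcard; have [eps eps0 h] := indep_row_open hF.
exists eps => // z' hz hlen.
(* Openness applies to the midpoint, which lies within [eps] of [z]; the factor 2 gives the point at
   which [len_diff] takes its rows. *)
have hm : indep (rig_row (fun k => 2 * (2^-1 * (z k + z' k)))) F.
  apply: indep_rowZ; rewrite ?pnatr_eq0 //; apply: h => k.
  have -> : 2^-1 * (z k + z' k) - z k = 2^-1 * (z' k - z k) by field.
  have := hz k; rewrite normrM ger0_norm; lra.
have mE : (fun k => 2 * (2^-1 * (z k + z' k))) = (fun k => z k + z' k).
  by apply: funext => k; field.
rewrite mE in hm; have [|e|e he||c hc] := @corank1_kernel _ _ _ _ F translation (fun k => z' k - z k) hm.
- by rewrite hcard card_prod card_bool mulnC.
- by rewrite row_translation.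
- by have := hlen e he => /eqP; rewrite -subr_eq0 len_diff => /eqP.
- by exists (v0, false); rewrite /translation /= oner_neq0.
by exists c => k; rewrite -hc addrC subrK.
Qed.

Lemma len_add z d e : len (fun k => z k + d k) e - len z e =
  2 * \sum_k rig_row z e k * d k + len d e.
Proof.
rewrite row_dot /len mulr_sumr -sumrB -big_split /=.
by apply: eq_bigr => b _; rewrite delD; ring.
Qed.

(** Solve [d = t * u - 1/2 * W (len d)] with [u] in the kernel of the rows of [F0]: as [W] is a
    right inverse, the second-order term of [len_add] cancels exactly on [F0]. *)
Lemma reduced_flexible (v0 : V) z (F F0 : {set E}) : F0 \subset F ->
  indep (rig_row z) F0 -> (#|F0|.+1 < 2 * #|V|)%N ->
  (forall z' e, e \in F -> e \notin F0 -> ~ indep (rig_row z') (e |: F0)) ->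
  forall eps : R, 0 < eps -> exists z', [/\ forall k, `|z' k - z k| < eps,
    forall e, e \in F -> len z' e = len z e &
    ~ exists c, forall k, z' k = z k + c * translation k].
Proof.
move=> sF0 hF0 hcard hmax eps eps0.
have [W hW] := indep_rinv hF0.
have [eps1 eps10 hopen] := indep_row_open hF0.
(* The additional row [None] pins the coordinate of [v0] along the mirror, so that [u] is not a
   translation. *)
pose M (o : option E) k : R := if o is Some e then rig_row z e k else (k == (v0, false))%:R.
have [|u [k0 hk0] hu] := @exists_kernel_vector _ _ _ M (None |: Some @: F0).
  rewrite cardsU1 card_imset; last by move=> ? ? [].
  rewrite card_prod card_bool mulnC; apply: leq_ltn_trans hcard.
  by rewrite -add1n leq_add2r leq_b1.
have u0 : u (v0, false) = 0.
  by rewrite -[LHS]sum_delta -[RHS](hu None) // !inE.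
have uF e : e \in F0 -> \sum_k rig_row z e k * u k = 0.
  by move=> he; apply: (hu (Some e)); rewrite !inE /=; apply/imsetP; exists e.
pose q k i j := - 2^-1 * \sum_(e in F0) W k e * \sum_b dcoef e b i * dcoef e b j.
have qE d k : \sum_i \sum_j q k i j * (d i * d j) =
    - 2^-1 * \sum_(e in F0) W k e * len d e.
  transitivity (\sum_i \sum_j \sum_(e in F0) \sum_b
      (- 2^-1 * W k e * ((dcoef e b i * d i) * (dcoef e b j * d j)))).
    apply: eq_bigr => i _; apply: eq_bigr => j _.
    rewrite /q mulr_sumr mulr_suml; apply: eq_bigr => e _.
    rewrite !mulr_sumr mulr_suml; apply: eq_bigr => b _; ring.
  under eq_bigr => i _ do rewrite exchange_big /=.
  rewrite exchange_big mulr_sumr /=; apply: eq_bigr => e _.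
  under eq_bigr => i _ do rewrite exchange_big /=.
  rewrite exchange_big /= /len !mulr_sumr /=; apply: eq_bigr => b _.
  under eq_bigr => i _ do rewrite -mulr_sumr -mulr_sumr.
  by rewrite -mulr_sumr -mulr_suml -del_sum; ring.
have min0 : 0 < Num.min eps eps1 by rewrite lt_min eps0.
have hu0 : exists k, u k != 0 by exists k0.
have [t [d [[k1 hk1] hdeps] hd]] := small_quadratic_solution q min0 hu0.
have hlen0 e : e \in F0 -> len (fun k => z k + d k) e = len z e.
  move=> he; apply/eqP; rewrite -subr_eq0 len_add; apply/eqP.
  suff -> : \sum_k rig_row z e k * d k = - 2^-1 * len d e by field.
  under eq_bigr => k _ do rewrite hd qE mulrDr mulrCA.
  rewrite big_split /= -mulr_sumr uF // mulr0 add0r.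
  under eq_bigr => k _ do rewrite mulrCA mulr_sumr.
  rewrite -mulr_sumr exchange_big /= (bigD1 e) //= [X in _ * (_ + X)]big1 => [|f].
    rewrite addr0; under eq_bigr => k _ do rewrite mulrA.
    by rewrite -mulr_suml hW // eqxx mul1r.
  move=> /andP[hf hfe]; under eq_bigr => k _ do rewrite mulrA.
  by rewrite -mulr_suml hW // eq_sym (negbTE hfe) mul0r.
exists (fun k => z k + d k); split.
- by move=> k; rewrite addrC addKr; have := hdeps k; rewrite lt_min => /andP[].
- move=> e he; case: (boolP (e \in F0)) => heF0; first exact: hlen0.
  have hm : indep (rig_row (fun k => 2 * (2^-1 * (z k + (z k + d k))))) F0.
    apply: indep_rowZ; rewrite ?pnatr_eq0 //; apply: hopen => k.
    have -> : 2^-1 * (z k + (z k + d k)) - z k = 2^-1 * d k by field.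
    have := hdeps k; rewrite lt_min => /andP[_].
    by rewrite normrM ger0_norm; have := normr_ge0 (d k); lra.
  have mE : (fun k => 2 * (2^-1 * (z k + (z k + d k)))) = (fun k => z k + (z k + d k)).
    by apply: funext => k; field.
  (* The coefficients [c] depend on the midpoint, which is harmless because [len_diff] is exact
     there. *)
  have [c hc] := max_indep_span hm (hmax _ e he heF0).
  apply/eqP; rewrite -subr_eq0 len_diff -mE; apply/eqP.
  under eq_bigr => k _ do rewrite hc mulr_suml.
  rewrite exchange_big big1 //= => f hf.
  under eq_bigr => k _ do rewrite -mulrA.
  by rewrite -mulr_sumr mE -len_diff hlen0 // subrr mulr0.
(* A translation has [len d = 0], so the correction vanishes and [d = t * u], which is 0 at
   [(v0, false)]; this forces [c = 0]. *)
- move=> [c hc]; have dE k : d k = c * translation k by apply: (addrI (z k)).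
  have len0 e : len d e = 0.
    rewrite /len big1 // => b _; rewrite /del !dE /translation /=.
    by case: b; rewrite /= ?mulr1 ?mulr0 /sgb ?mul1r ?subrr expr0n.
  have dt k : d k = t * u k.
    by rewrite hd qE big1 ?mulr0 ?addr0 // => e _; rewrite len0 mulr0.
  have c0 : c = 0 by rewrite -[c]mulr1 -(dE (v0, false)) dt u0 mulr0.
  by move: hk1; rewrite dE c0 mul0r eqxx.
Qed.

End ReducedFramework.

(** * Sparsity and the Maxwell count *)

Lemma addrr_Z2 (a : 'Z_2) : a + a = 0.
Proof. by apply/val_inj; case: a => -[|[|]]. Qed.

Section Sparsity.
Variables (V E : finType) (src tgt : E -> V) (gam : E -> 'Z_2).

Definition potential (F : {set E}) (s : V -> 'Z_2) :=
  forall e, e \in F -> gam e = s (tgt e) + s (src e).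

Definition balanced (F : {set E}) := exists s, potential F s.

(** The defining counts without components; [reflection_lamanP] recovers the original ones by
    summing over components. *)
Definition sparse (F : {set E}) := forall X : {set E}, X \subset F -> X != set0 ->
  (#|X| + 1 <= 2 * #|VF src tgt X|)%N /\
  (balanced X -> #|X| + 3 <= 2 * #|VF src tgt X|)%N.

Lemma mem_VF (X : {set E}) e : e \in X -> src e \in VF src tgt X /\ tgt e \in VF src tgt X.
Proof.
by move=> he; split; rewrite inE; apply/existsP; exists e; rewrite he eqxx ?orbT.
Qed.

Lemma VFP (X : {set E}) v : reflect (exists2 e, e \in X & src e = v \/ tgt e = v)
  (v \in VF src tgt X).
Proof.
rewrite inE; apply: (iffP existsP) => [[e /andP[he /orP[/eqP h|/eqP h]]]|[e he h]].
- by exists e => //; left.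
- by exists e => //; right.
by exists e; rewrite he; case: h => ->; rewrite eqxx ?orbT.
Qed.

End Sparsity.

Section Maxwell.
Variables (R : realType) (V E : finType) (src tgt : E -> V) (gam : E -> 'Z_2).
Notation rig_row := (@rig_row R V E src tgt gam).
Notation VF := (VF src tgt).

Lemma sgD (a b : 'Z_2) : @sg R (a + b) = sg R a * sg R b.
Proof. by rewrite /sg /= modn2 signr_odd exprD. Qed.

Lemma sg_sqr (a : 'Z_2) : @sg R a * sg R a = 1.
Proof. by rewrite /sg -expr2 sqrr_sign. Qed.

Lemma row_off (z : V * bool -> R) e k : k.1 != src e -> k.1 != tgt e -> rig_row z e k = 0.
Proof.
case: k => k b /= /negbTE h1 /negbTE h2; rewrite /rig_row big1 // => b' _.
by rewrite /dcoef !xpair_eqE h1 h2 /= mulr0 subr0 mulr0.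
Qed.

(** Rows of [X] vanish off the vertices of [X], so the dimension count takes place in the columns
    over [VF X], and only there must the motions be independent. *)
Lemma indep_motions_card (z : V * bool -> R) (X : {set E}) (G : finType)
    (N : G -> V * bool -> R) :
  indep (rig_row z) X ->
  (forall e g, e \in X -> \sum_k rig_row z e k * N g k = 0) ->
  (forall w, (forall k, k.1 \in VF X -> \sum_g w g * N g k = 0) -> forall g, w g = 0) ->
  (#|X| + #|G| <= 2 * #|VF X|)%N.
Proof.
move=> hX hN hG; pose A := finset.setX (VF X) [set: bool].
have AE k : (k \in A) = (k.1 \in VF X) by case: k => v b; rewrite !inE andbT.
have -> : (2 * #|VF X|)%N = #|{: 'I_#|A|}| by rewrite card_ord cardsX cardsT card_bool mulnC.
have off e k : e \in X -> k \notin A -> rig_row z e k = 0.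
  move=> /(mem_VF src tgt) [h1 h2]; rewrite AE => hk.
  by apply: row_off; apply: contraNneq hk => ->.
have offs (f : V * bool -> R) : (forall k, k \notin A -> f k = 0) ->
    \sum_k f k = \sum_(i < #|A|) f (enum_val i).
  move=> hf; rewrite (bigID (mem A)) /= [X in _ + X]big1 // addr0.
  exact: big_enum_val.
apply: (indep_orth_card (M := fun e i => rig_row z e (enum_val i))
                        (N := fun g i => N g (enum_val i))).
- move=> w hw; apply: hX => k; case: (boolP (k \in A)) => hk.
    by have := hw (enum_rank_in hk k); rewrite enum_rankK_in.
  by rewrite big1 // => e he; rewrite off ?mulr0.
- move=> w hw g _; apply: hG => k; rewrite -AE => hk.
  by have := hw (enum_rank_in hk k); rewrite enum_rankK_in // (eq_bigl predT) // => i; rewrite inE.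
- move=> e g he; rewrite -[RHS](hN e g he) [RHS]offs // => k hk.
  by rewrite off // mul0r.
Qed.

Lemma indep_del_neq0 (z : V * bool -> R) (X : {set E}) e : indep (rig_row z) X -> e \in X ->
  ~ (forall b, del src tgt gam z e b = 0).
Proof.
move=> hX he h0; suff /eqP : (e == e)%:R = 0 :> R by rewrite eqxx oner_eq0.
apply: (hX (fun f => (f == e)%:R)) => // k.
rewrite (bigD1 e) //= [X in _ + X]big1 => [|f /andP[_ /negbTE ->]]; last by rewrite mul0r.
by rewrite addr0 /rig_row big1 ?mulr0 // => b _; rewrite h0 mul0r.
Qed.

(** Switching by the signs [sg (s v)] turns a balanced subgraph into an unconstrained plane
    framework, which has three infinitesimal isometries instead of one. *)
Lemma indep_sparse (z : V * bool -> R) (F : {set E}) : indep (rig_row z) F ->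
  sparse src tgt gam F.
Proof.
move=> hF X sXF /set0Pn [e he]; have hX := indep_sub sXF hF.
have [hs ht] := mem_VF src tgt he; split.
  have := @indep_motions_card z X unit (fun _ => @translation R V) hX.
  rewrite card_unit; apply => [f g _|w hw []].
    by rewrite row_translation.
  by have := hw (src e, false) hs; rewrite (bigD1 tt) //= big1 ?addr0 ?mulr1 // => -[].
move=> [s hpot].
(* Translation along the mirror, signed translation across it, and rotation of the switched
   configuration. *)
pose N (g : 'I_3) (k : V * bool) : R :=
  if (g == 0 :> nat)%N then translation R k
  else if (g == 1 :> nat)%N then sg R (s k.1) * k.2%:R
  else sg R (s k.1) * (if k.2 then z (k.1, false) else - z (k.1, true)).
have := indep_motions_card (N := N) hX; rewrite card_ord; apply => [f g hf|w hw].
  have fE : sg R (gam f) = sg R (s (tgt f)) * sg R (s (src f)) by rewrite hpot // sgD.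
  have st := sg_sqr (s (tgt f)); have ss := sg_sqr (s (src f)).
  rewrite row_dot big_bool /del /sgb fE.
  case: g => -[|[|[|//]]] ?; rewrite /N /translation /=.
  - by rewrite !mulr0 !mulr1 !subrr !mulr0 addr0.
  - by ring: ss.
  - by ring: st ss.
set w0 := w ord0; set w1 := w (lift ord0 ord0); set w2 := w (lift ord0 (lift ord0 ord0)).
(* A relation with [w2 != 0] puts all switched points at one place, and then the row of [e] would be
   zero. *)
have hz (k : V) : k \in VF X ->
    w0 = w2 * (sg R (s k) * z (k, true)) /\ w1 = - (w2 * z (k, false)).
  move=> hk; have sk := sg_sqr (s k).
  have := hw (k, true) hk; have := hw (k, false) hk.
  rewrite !big_ord_recl !big_ord0 /N /translation /= -/w0 -/w1 -/w2 => h1 h2.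
  split; first by apply/eqP; rewrite -subr_eq0; apply/eqP; rewrite -[RHS]h1; ring.
  apply/eqP; rewrite -addr_eq0; apply/eqP.
  by rewrite -[RHS](mulr0 (sg R (s k))) -h2; ring: sk.
have [e1 f1] := hz _ hs; have [e2 f2] := hz _ ht.
have w20 : w2 = 0.
  apply/eqP/negPn/negP => w2n; apply: (indep_del_neq0 hX he) => b.
  have hy : sg R (s (tgt e)) * z (tgt e, true) = sg R (s (src e)) * z (src e, true).
    by apply: (mulfI w2n); rewrite -e1 -e2.
  have hx : z (tgt e, false) = z (src e, false).
    by apply: (mulfI w2n); apply: oppr_inj; rewrite -f1 -f2.
  have st := sg_sqr (s (tgt e)); have ss := sg_sqr (s (src e)).
  rewrite /del /sgb; case: b; last by rewrite hx mul1r subrr.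
  by rewrite hpot // sgD -mulrA -hy mulrA st mul1r subrr.
case=> -[|[|[|//]]] hi; [have <- : ord0 = Ordinal hi | have <- : lift ord0 ord0 = Ordinal hi
  | have <- : lift ord0 (lift ord0 ord0) = Ordinal hi]; try exact: val_inj.
- by rewrite -/w0 e1 w20 mul0r.
- by rewrite -/w1 f1 w20 mul0r oppr0.
- exact: w20.
Qed.

End Maxwell.

(** * Blockers of edge insertions at a vertex of degree three *)

(* The context contains many facts that slow lia down and that it cannot use. *)
Ltac card_lia := intros;
  repeat match goal with
  | H : is_true (leq _ _) |- _ => revert H
  | H : @eq nat _ _ |- _ => revert H
  end; clear; lia.

Section Blockers.
Variables (V E : finType) (src tgt : E -> V) (gam : E -> 'Z_2).
Notation VF := (VF src tgt).
Notation potential := (potential src tgt gam).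
Notation balanced := (balanced src tgt gam).
Notation sparse := (sparse src tgt gam).
Implicit Types X Y Z H : {set E}.

Lemma VFU X Y : VF (X :|: Y) = VF X :|: VF Y.
Proof.
apply/setP => v; rewrite in_setU; apply/VFP/orP.
  by move=> [e]; rewrite in_setU => /orP[] he h; [left|right]; apply/VFP; exists e.
by move=> [] /VFP [e he h]; exists e; rewrite // in_setU he ?orbT.
Qed.

Lemma VF_sub X Y : X \subset Y -> VF X \subset VF Y.
Proof. by move=> /setUidPr <-; rewrite VFU subsetUl. Qed.

Lemma card_VFI X Y : (#|VF (X :&: Y)| <= #|VF X :&: VF Y|)%N.
Proof. by apply: subset_leq_card; rewrite subsetI !VF_sub ?subsetIl ?subsetIr. Qed.

Lemma potential_sub X Y s : X \subset Y -> potential Y s -> potential X s.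
Proof. by move=> /subsetP h hp e /h; apply: hp. Qed.

Variables (H : {set E}) (hs : sparse H).

Lemma sparse_card X : X \subset H -> X != set0 -> (#|X| + 1 <= 2 * #|VF X|)%N.
Proof. by move=> h1 h2; case: (hs h1 h2). Qed.

Lemma sparse_balanced_card X s : X \subset H -> potential X s -> X != set0 ->
  (#|X| + 3 <= 2 * #|VF X|)%N.
Proof. by move=> h1 h3 h2; case: (hs h1 h2) => _; apply; exists s. Qed.

(* Two potentials of X and Y that agree at a common vertex and disagree at another one
   cut the common edges into two balanced parts. *)
Lemma disagreeing_card X Y s t i j : X \subset H -> Y \subset H ->
  potential X s -> potential Y t ->
  i \in VF X :&: VF Y -> s i = t i -> j \in VF X :&: VF Y -> s j != t j ->
  X :&: Y != set0 -> (#|X :&: Y| + 5 <= 2 * #|VF X :&: VF Y|)%N.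
Proof.
move=> sX sY hX hY hi si hj sj hn.
pose D b := [set v in VF X :&: VF Y | (s v == t v) == b].
pose B b := [set e in X :&: Y | (s (src e) == t (src e)) == b].
have cD : (#|D true| + #|D false| = #|VF X :&: VF Y|)%N.
  rewrite -(cardsID [set v | s v == t v] (VF X :&: VF Y)); congr (_ + _)%N; apply: eq_card => v.
    by rewrite !inE eqb_id.
  by rewrite !inE eqbF_neg andbC.
have cB : (#|B true| + #|B false| = #|X :&: Y|)%N.
  rewrite -(cardsID [set e | s (src e) == t (src e)] (X :&: Y)).
  congr (_ + _)%N; apply: eq_card => v.
    by rewrite !inE eqb_id.
  by rewrite !inE eqbF_neg andbC.
have iD : (0 < #|D true|)%N by apply/card_gt0P; exists i; rewrite inE hi si eqxx.
have jD : (0 < #|D false|)%N by apply/card_gt0P; exists j; rewrite inE hj (negbTE sj).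
have VB b : VF (B b) \subset D b.
  apply/subsetP => v /VFP [e]; rewrite inE => /andP[he hb].
  have [eX eY] : e \in X /\ e \in Y by move: he; rewrite inE => /andP.
  (* Both potentials differ by [gam e] along [e], so agreement at one end is agreement at the
     other. *)
  have tE : (s (tgt e) == t (tgt e)) = (s (src e) == t (src e)).
    have hg := hX e eX; have hg' := hY e eY; rewrite hg in hg'.
    by apply/eqP/eqP => h; [move: hg'; rewrite h => /addrI | move: hg'; rewrite h => /addIr].
  have [h1 h2] := mem_VF src tgt eX; have [h3 h4] := mem_VF src tgt eY.
  by case=> <-; rewrite inE in_setI ?h1 ?h2 ?h3 ?h4 ?tE.
have sB b : B b \subset X.
  by apply/subsetP => e; rewrite !inE => /andP[/andP[]].
have hB b : B b = set0 \/ (#|B b| + 3 <= 2 * #|D b|)%N.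
  have [->|hne] := eqVneq (B b) set0; [by left|right].
  have := sparse_balanced_card (subset_trans (sB b) sX) (potential_sub (sB b) hX) hne.
  have := subset_leq_card (VB b); card_lia.
(* Two nonempty edge parts give 3 + 3; an empty one still has a vertex, and this gives 3 + 2. *)
move: hn; rewrite -card_gt0 -cB.
by case: (hB true) => [->|]; case: (hB false) => [->|]; rewrite ?cards0; card_lia.
Qed.

Variables (i1 i2 i3 : V) (c1 c2 c3 : 'Z_2).

(* What sparsity says about the edges spanning the three neighbors of a removed vertex. *)
Definition deg3_unbalanced := forall X, X \subset H ->
  i1 \in VF X -> i2 \in VF X -> i3 \in VF X -> (#|X| + 2 <= 2 * #|VF X|)%N.

Definition deg3_balanced := forall X s, X \subset H -> potential X s ->
  i1 \in VF X -> i2 \in VF X -> i3 \in VF X ->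
  s i1 = c1 -> s i2 = c2 -> s i3 = c3 -> (#|X| + 4 <= 2 * #|VF X|)%N.

End Blockers.

Notation inS := (in_setU, in_setI, in_set1).

Section Blocked.
Variables (V E : finType) (src tgt : E -> V) (gam : E -> 'Z_2).
Notation VF := (VF src tgt).
Notation potential := (potential src tgt gam).
Notation sparse := (sparse src tgt gam).
Variables (H : {set E}) (hs : sparse H).
Implicit Types X Y Z : {set E}.

(** Tight for the unbalanced count: it excludes an additional edge from [a] to [b] of any color. *)
Definition ublock X (a b : V) :=
  [/\ X \subset H, a \in VF X, b \in VF X & (#|X| + 1 = 2 * #|VF X|)%N].

(* (a, ca) and (b, cb) are the lifts of two neighbors of the removed vertex: a balanced
   blocker already fixes their distance. *)
Definition bblock X s (a : V) (ca : 'Z_2) (b : V) (cb : 'Z_2) :=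
  [/\ X \subset H, a \in VF X, b \in VF X & a != b] /\
  [/\ potential X s, s a = ca, s b = cb & (#|X| + 3 = 2 * #|VF X|)%N].

Definition blocked a ca b cb :=
  (exists X, ublock X a b) \/ exists X s, bblock X s a ca b cb.

Lemma ublockC X a b : ublock X a b -> ublock X b a.
Proof. by case. Qed.

Lemma bblockC X s a ca b cb : bblock X s a ca b cb -> bblock X s b cb a ca.
Proof. by move=> [[? ? ?]]; rewrite eq_sym => ? []. Qed.

(** Submodularity leaves [X :|: Y] too little slack: it spans all three neighbors, where
    [deg3_unbalanced] asks for 2. *)
Lemma UU_block X Y a b c : deg3_unbalanced src tgt H a b c ->
  ublock X a b -> ublock Y a c -> False.
Proof.
move=> hU [sX aX bX cX] [sY aY bY cY].
have hW := hU (X :|: Y); rewrite VFU !inS aX bX bY /= ?orbT in hW.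
have {}hW := hW _ isT isT isT; rewrite subUset sX sY in hW; have {}hW := hW isT.
have := cardsUI X Y; have := cardsUI (VF X) (VF Y).
have : (0 < #|VF X :&: VF Y|)%N by apply/card_gt0P; exists a; rewrite inS aX.
have : X :&: Y = set0 \/ (#|X :&: Y| + 1 <= 2 * #|VF X :&: VF Y|)%N.
  have [->|hne] := eqVneq (X :&: Y) set0; [by left|right].
  have := sparse_card hs (subset_trans (subsetIl X Y) sX) hne.
  have := card_VFI src tgt X Y; card_lia.
by case=> [->|]; rewrite ?cards0; card_lia.
Qed.

(** The bound on the union forces at least [2k - 2] common edges on [k] common vertices, one more
    than a nonempty balanced set may have. So there are none, and [k = 1]. *)
Lemma UB_block X Y s a b ca c cc : deg3_unbalanced src tgt H a b c ->
  ublock X a b -> bblock Y s a ca c cc -> X :&: Y = set0 /\ VF X :&: VF Y = [set a].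
Proof.
move=> hU [sX aX bX cX] [[sY aY bY _] [pY _ _ cY]].
have hW := hU (X :|: Y); rewrite VFU !inS aX bX bY /= ?orbT in hW.
have {}hW := hW _ isT isT isT; rewrite subUset sX sY in hW; have {}hW := hW isT.
have := cardsUI X Y; have := cardsUI (VF X) (VF Y).
have sa : [set a] \subset VF X :&: VF Y by rewrite sub1set inS aX.
have := subset_leq_card sa; rewrite cards1.
have [h0|hne] := eqVneq (X :&: Y) set0.
  rewrite h0 cards0 => h1 h2 h3; split=> //; apply/esym/eqP.
  by rewrite eqEcard sa cards1; card_lia.
have := sparse_balanced_card hs (subset_trans (subsetIr X Y) sY)
  (potential_sub (subsetIr X Y) pY) hne.
have := card_VFI src tgt X Y; card_lia.
Qed.

(** The bound on the union forces at least [2k - 4] common edges on [k] common vertices, against at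
    most [2k - 5] by [disagreeing_card] if there are any; hence none, and [k = 2]. *)
Lemma BB_block_disagree X Y s t a ca b cb c cc j : deg3_unbalanced src tgt H a b c ->
  bblock X s a ca b cb -> bblock Y t a ca c cc ->
  j \in VF X :&: VF Y -> s j != t j ->
  X :&: Y = set0 /\ #|VF X :&: VF Y| = 2.
Proof.
move=> hU [[sX aX bX _] [pX sa _ cX]] [[sY aY bY _] [pY ta _ cY]] hj hst.
have hW := hU (X :|: Y); rewrite VFU !inS aX bX bY /= ?orbT in hW.
have {}hW := hW _ isT isT isT; rewrite subUset sX sY in hW; have {}hW := hW isT.
have := cardsUI X Y; have := cardsUI (VF X) (VF Y).
have ha : a \in VF X :&: VF Y by rewrite inS aX.
have sta : s a = t a by rewrite sa ta.
have haj : a != j by apply: contraNneq hst => <-; rewrite sta.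
have saj : [set a; j] \subset VF X :&: VF Y by rewrite subUset !sub1set ha.
have := subset_leq_card saj; rewrite cards2 haj.
have [h0|hne] := eqVneq (X :&: Y) set0.
  by rewrite h0 cards0 => h1 h2 h3; split=> //; card_lia.
have := disagreeing_card hs sX sY pX pY ha sta hj hst hne; card_lia.
Qed.

Definition glue X (s t : V -> 'Z_2) v := if v \in VF X then s v else t v.

Lemma potential_glue X Y s t : potential X s -> potential Y t ->
  (forall v, v \in VF X :&: VF Y -> s v = t v) -> potential (X :|: Y) (glue X s t).
Proof.
move=> pX pY hag e; rewrite in_setU /glue; case: (boolP (e \in X)) => /= heX.
  by have [-> ->] := mem_VF src tgt heX => _; exact: pX.
move=> heY; have [h1 h2] := mem_VF src tgt heY; rewrite pY //.
by congr (_ + _); case: ifP => // h; rewrite hag // inS h.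
Qed.

(** Agreeing potentials glue, so [deg3_balanced] applies to the union: at least [2k - 2] common
    edges on [k] common vertices, against at most [2k - 3] if there are any. *)
Lemma BB_block_agree X Y s t a ca b cb c cc : deg3_balanced src tgt gam H a b c ca cb cc ->
  bblock X s a ca b cb -> bblock Y t a ca c cc ->
  (forall v, v \in VF X :&: VF Y -> s v = t v) ->
  X :&: Y = set0 /\ #|VF X :&: VF Y| = 1%N.
Proof.
move=> hB [[sX aX bX _] [pX sa sb cX]] [[sY aY bY _] [pY ta tc cY]] hag.
have hW := hB (X :|: Y) _ _ (potential_glue pX pY hag).
rewrite VFU !inS aX bX bY /= ?orbT /glue aX bX in hW.
have {}hW := hW _ isT isT isT sa sb; rewrite subUset sX sY in hW; have {}hW := hW isT.
have {}hW : (#|X :|: Y| + 4 <= 2 * #|VF X :|: VF Y|)%N.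
  by apply: hW; case: ifP => // h; rewrite hag // inS h.
have := cardsUI X Y; have := cardsUI (VF X) (VF Y).
have : (0 < #|VF X :&: VF Y|)%N by apply/card_gt0P; exists a; rewrite inS aX.
have [h0|hne] := eqVneq (X :&: Y) set0.
  by rewrite h0 cards0 => h1 h2 h3; split=> //; card_lia.
have := sparse_balanced_card hs (subset_trans (subsetIr X Y) sY)
  (potential_sub (subsetIr X Y) pY) hne.
have := card_VFI src tgt X Y; card_lia.
Qed.

Lemma cardsU3 (T : finType) (P Q S : {set T}) :
  (#|P :|: Q :|: S| + #|P :&: Q| + #|P :&: S| + #|Q :&: S| =
   #|P| + #|Q| + #|S| + #|P :&: Q :&: S|)%N.
Proof.
have h1 := cardsUI (P :|: Q) S; have h2 := cardsUI P Q.
rewrite setIUl in h1; have h3 := cardsUI (P :&: S) (Q :&: S).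
have : (P :&: S) :&: (Q :&: S) = P :&: Q :&: S by rewrite setIACA setIid.
by move=> h4; rewrite h4 in h3; card_lia.
Qed.

(** By [UB_block] the set [X] meets [Y] only at [a] and [Z] only at [b], and inclusion-exclusion
    makes the union too large. If [a = b], all three meet there, but [Y] and [Z] disagree at [a], so
    they share two vertices and no edge, which compensates. *)
Lemma UBB_block X Y Z s t a ca b cb c cc : deg3_unbalanced src tgt H a b c ->
  (a = b -> ca != cb) ->
  ublock X a b -> bblock Y s a ca c cc -> bblock Z t b cb c cc -> False.
Proof.
move=> hU hab bX bY bZ.
have hU' : deg3_unbalanced src tgt H b a c by move=> ? ? ? ? ?; apply: hU.
have [XY VXY] := UB_block hU bX bY.
have [XZ VXZ] := UB_block hU' (ublockC bX) bZ.
case: bX => sX aX bX cX.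
have hb := bY; have hb' := bZ.
case: bY => [[sY aY cVY _] [pY sa sc cY]]; case: bZ => [[sZ bVZ cZ _] [pZ tb tc cdZ]].
have hW : (#|X :|: Y :|: Z| + 2 <= 2 * #|VF X :|: VF Y :|: VF Z|)%N.
  by rewrite -!VFU; apply: hU; rewrite ?subUset ?sX ?sY // !VFU !inS ?aX ?bX ?cZ ?orbT.
have := cardsU3 X Y Z; have := cardsU3 (VF X) (VF Y) (VF Z).
rewrite XY XZ VXY VXZ !cards1 set0I !cards0.
have [eab|nab] := eqVneq a b.
  have ha : a \in VF Z :&: VF Y by rewrite inS aY eab bVZ.
  have hU2 : deg3_unbalanced src tgt H c b a by move=> ? ? ? ? ?; apply: hU.
  have [] := BB_block_disagree (j := a) hU2 (bblockC hb') (bblockC hb) ha.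
    by rewrite {1}eab tb sa eq_sym; apply: hab.
  rewrite setIC [VF Z :&: _]setIC => -> ->; rewrite cards0.
  have : (#|[set a] :&: VF Z| <= 1)%N.
    by rewrite -(cards1 a); apply: subset_leq_card; exact: subsetIl.
  have : (0 < #|[set a] :&: VF Z|)%N by apply/card_gt0P; exists a; rewrite !inS eqxx eab.
  card_lia.
have -> : [set a] :&: VF Z = set0.
  apply/eqP; rewrite -subset0; apply/subsetP => v; rewrite !inS => /andP[/eqP -> haZ].
  have : a \in VF X :&: VF Z by rewrite inS aX.
  by rewrite VXZ inS (negbTE nab).
rewrite cards0.
have : (0 < #|VF Y :&: VF Z|)%N by apply/card_gt0P; exists c; rewrite inS cVY.
have : Y :&: Z = set0 \/ (#|Y :&: Z| + 3 <= 2 * #|VF Y :&: VF Z|)%N.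
  have [->|hne] := eqVneq (Y :&: Z) set0; [by left|right].
  have := sparse_balanced_card hs (subset_trans (subsetIl Y Z) sY)
    (potential_sub (subsetIl Y Z) pY) hne.
  have := card_VFI src tgt Y Z; card_lia.
by case=> [->|]; rewrite ?cards0; card_lia.
Qed.

(** The blockers are edge-disjoint. With [k] the sum of the pairwise vertex intersections and [h]
    the triple one, the union has [2n - 9 + 2(k - h)] edges on [n] vertices. Each of [a], [b], [c]
    lies in two blockers, so [k - 2h >= 3], and the unbalanced count leaves only [k = 3], [h = 0].
    Then all potentials agree and glue, and the balanced count fails. *)
Lemma BBB_block X Y Z s t u a ca b cb c cc : deg3_unbalanced src tgt H a b c ->
  deg3_balanced src tgt gam H a b c ca cb cc ->
  bblock X s a ca b cb -> bblock Y t a ca c cc -> bblock Z u b cb c cc -> False.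
Proof.
move=> hU hB bX bY bZ.
have agreeP P Q (p q : V -> 'Z_2) : (forall v, v \in VF P :&: VF Q -> p v = q v) \/
    exists2 j, j \in VF P :&: VF Q & p j != q j.
  have [/forall_inP h|] := boolP [forall v in VF P :&: VF Q, p v == q v].
    by left=> v /h /eqP.
  by rewrite negb_forall_in => /exists_inP; right.
have XY : X :&: Y = set0 /\ (#|VF X :&: VF Y| = 2 \/
    (#|VF X :&: VF Y| = 1%N /\ forall v, v \in VF X :&: VF Y -> s v = t v)).
  case: (agreeP X Y s t) => [h|[j hj h]].
    by have [-> ->] := BB_block_agree hB bX bY h; split=> //; right.
  by have [-> ->] := BB_block_disagree hU bX bY hj h; split=> //; left.
have XZ : X :&: Z = set0 /\ (#|VF X :&: VF Z| = 2 \/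
    (#|VF X :&: VF Z| = 1%N /\ forall v, v \in VF X :&: VF Z -> s v = u v)).
  have hU' : deg3_unbalanced src tgt H b a c by move=> ? ? ? ? ?; apply: hU.
  have hB' : deg3_balanced src tgt gam H b a c cb ca cc.
    by move=> P p ? ? ? ? ? ? ? ?; apply: (hB P p).
  case: (agreeP X Z s u) => [h|[j hj h]].
    by have [-> ->] := BB_block_agree hB' (bblockC bX) bZ h; split=> //; right.
  by have [-> ->] := BB_block_disagree hU' (bblockC bX) bZ hj h; split=> //; left.
have YZ : Y :&: Z = set0 /\ (#|VF Y :&: VF Z| = 2 \/
    (#|VF Y :&: VF Z| = 1%N /\ forall v, v \in VF Y :&: VF Z -> t v = u v)).
  have hU' : deg3_unbalanced src tgt H c a b by move=> ? ? ? ? ?; apply: hU.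
  have hB' : deg3_balanced src tgt gam H c a b cc ca cb.
    by move=> P p ? ? ? ? ? ? ? ?; apply: (hB P p).
  case: (agreeP Y Z t u) => [h|[j hj h]].
    by have [-> ->] := BB_block_agree hB' (bblockC bY) (bblockC bZ) h; split=> //; right.
  by have [-> ->] := BB_block_disagree hU' (bblockC bY) (bblockC bZ) hj h; split=> //; left.
case: bX => [[sX aX bX nab] [pX sa sb cX]].
case: bY => [[sY aY cVY nac] [pY ta tc cY]].
case: bZ => [[sZ bVZ cZ nbc] [pZ ub uc cdZ]].
have hW : (#|X :|: Y :|: Z| + 2 <= 2 * #|VF X :|: VF Y :|: VF Z|)%N.
  by rewrite -!VFU; apply: hU; rewrite ?subUset ?sX ?sY // !VFU !inS ?aX ?bX ?cZ ?orbT.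
have := cardsU3 X Y Z; have := cardsU3 (VF X) (VF Y) (VF Z).
move: XY XZ YZ => [-> kXY] [-> kXZ] [-> kYZ]; rewrite set0I !cards0.
pose M := VF X :&: VF Y :|: VF X :&: VF Z :|: VF Y :&: VF Z.
have M3 : (3 <= #|M|)%N.
  have : [set a; b; c] \subset M.
    by rewrite !subUset !sub1set !inS aX aY bX bVZ cVY cZ /= ?orbT.
  move/subset_leq_card; apply: leq_trans; rewrite setUC cardsU1 !inS.
  by rewrite cards2 eq_sym (negbTE nac) eq_sym (negbTE nbc) nab.
have := cardsU3 (VF X :&: VF Y) (VF X :&: VF Z) (VF Y :&: VF Z).
rewrite -/M.
have -> : (VF X :&: VF Y) :&: (VF X :&: VF Z) = VF X :&: VF Y :&: VF Z.
  by apply/setP => v; rewrite !inS; do !case: (v \in _).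
have -> : (VF X :&: VF Y) :&: (VF Y :&: VF Z) = VF X :&: VF Y :&: VF Z.
  by apply/setP => v; rewrite !inS; do !case: (v \in _).
have -> : (VF X :&: VF Z) :&: (VF Y :&: VF Z) = VF X :&: VF Y :&: VF Z.
  by apply/setP => v; rewrite !inS; do !case: (v \in _).
have -> : (VF X :&: VF Y :&: VF Z) :&: (VF Y :&: VF Z) = VF X :&: VF Y :&: VF Z.
  by apply/setP => v; rewrite !inS; do !case: (v \in _).
case: kXY => [kXY|[kXY aXY]]; first by case: kXZ => [|[]] ? ?; case: kYZ => [|[]] ? ?; card_lia.
case: kXZ => [kXZ|[kXZ aXZ]]; first by case: kYZ => [|[]] ? ?; card_lia.
case: kYZ => [kYZ|[kYZ aYZ]]; first by card_lia.
have pot : potential (X :|: Y :|: Z) (glue (X :|: Y) (glue X s t) u).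
  apply: potential_glue => //; first exact: potential_glue.
  move=> v; rewrite VFU setIUl /glue => /setUP [] /[dup] hv.
    by rewrite inS => /andP[-> _]; apply: aXZ.
  rewrite inS => /andP[hY hZ]; case: ifP => hX; last by apply: aYZ.
  by apply: aXZ; rewrite inS hX.
have := hB _ _ _ pot; rewrite !VFU !inS aX bX cZ ?orbT /= /glue VFU !inS aX bX cVY ?orbT /=.
move=> h; have {h} := h _ isT isT isT sa sb; rewrite !subUset sX sY sZ.
move=> h; have {}h : (#|X :|: Y :|: Z| + 4 <= 2 * #|VF X :|: VF Y :|: VF Z|)%N.
  apply: h => //; case: ifP => // h; rewrite -tc; apply: aXY; by rewrite inS h.
card_lia.
Qed.

Lemma not_all_blocked a ca b cb c cc : deg3_unbalanced src tgt H a b c ->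
  deg3_balanced src tgt gam H a b c ca cb cc ->
  (a = b -> ca != cb) -> (a = c -> ca != cc) -> (b = c -> cb != cc) ->
  blocked a ca b cb -> blocked a ca c cc -> blocked b cb c cc -> False.
Proof.
move=> hU hB hab hac hbc.
have hUa : deg3_unbalanced src tgt H b a c by move=> ? ? ? ? ?; apply: hU.
have hUb : deg3_unbalanced src tgt H a c b by move=> ? ? ? ? ?; apply: hU.
have hUc : deg3_unbalanced src tgt H c a b by move=> ? ? ? ? ?; apply: hU.
have hUd : deg3_unbalanced src tgt H b c a by move=> ? ? ? ? ?; apply: hU.
move=> [[X bX]|[X [s bX]]] [[Y bY]|[Y [t bY]]] [[Z bZ]|[Z [u bZ]]].
- exact: (UU_block hU bX bY).
- exact: (UU_block hU bX bY).
- exact: (UU_block hUa (ublockC bX) bZ).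
- exact: (UBB_block hU hab bX bY bZ).
- exact: (UU_block hUc (ublockC bY) (ublockC bZ)).
- exact: (UBB_block hUb hac bY bX (bblockC bZ)).
- exact: (UBB_block hUd hbc bZ (bblockC bX) (bblockC bY)).
- exact: (BBB_block hU hB bX bY bZ).
Qed.

End Blocked.

(** * Henneberg moves *)

Lemma exists_small_avoiding (R : realFieldType) (s : seq R) (d : R) : 0 < d ->
  exists2 t, 0 < t < d & t \notin s.
Proof.
move=> d0; pose f (k : nat) := d / k.+2%:R.
have fI : injective f.
  move=> i j /(mulfI (lt0r_neq0 d0)) /invr_inj /eqP; rewrite eqr_nat => /eqP; lia.
have [k _ hk] : exists2 k, k \in iota 0 (size s).+1 & f k \notin s.
  apply: contrapT => h.
  have := @uniq_leq_size _ [seq f i | i <- iota 0 (size s).+1] s.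
  rewrite (map_inj_uniq fI) iota_uniq size_map size_iota ltnn.
  suff hs : {subset [seq f i | i <- iota 0 (size s).+1] <= s} by move=> /(_ isT hs).
  by move=> _ /mapP [k hk ->]; apply/negPn/negP => hn; apply: h; exists k.
exists (f k) => //; rewrite /f divr_gt0 //= ltr_pdivrMr // ltr_pMr // ltr1n //.
Qed.

Lemma sum_setU (K : zmodType) (E : finType) (A B : {set E}) (f : E -> K) :
  [disjoint A & B] -> \sum_(e in A :|: B) f e = \sum_(e in A) f e + \sum_(e in B) f e.
Proof. by move=> hd; rewrite -bigU //=; apply: eq_bigl => e; rewrite !inE. Qed.

Section Extension.
Variables (R : realType) (V E : finType) (src tgt : E -> V) (gam : E -> 'Z_2).
Notation rig_row := (@rig_row R V E src tgt gam).
Notation sgb := (sgb R).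
Implicit Types (z : V * bool -> R) (F H D : {set E}).

(** A vertex off the mirror differs from its mirror image, and distinct vertices differ in the
    coordinate that no color affects. *)
Definition general_position z :=
  (forall u w, u != w -> z (u, false) != z (w, false)) /\ forall u, z (u, true) != 0.

(** All vertices move with distinct speeds along the mirror and unit speed across it; only finitely
    many times [t] are bad. *)
Lemma indep_general_position z F : indep (rig_row z) F ->
  exists2 z', indep (rig_row z') F & general_position z'.
Proof.
move=> /indep_row_open [eps eps0 hopen].
pose r (u : V) : R := (enum_rank u : nat)%:R.
pose bad := [seq - z (u, true) | u : V] ++
  [seq (z (u.1, false) - z (u.2, false)) / (r u.2 - r u.1) | u : V * V].
have n0 : 0 < #|V|%:R + 1 :> R by rewrite ltr_wpDl.
have [|t /andP[t0 td]] := @exists_small_avoiding R bad (eps / (#|V|%:R + 1)).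
  exact: divr_gt0.
rewrite mem_cat negb_or => /andP[hb1 hb2].
exists (fun k => z k + t * (if k.2 then 1 else r k.1)).
  apply: hopen => k; rewrite addrC addKr normrM gtr0_norm //.
  have hk : `|if k.2 then 1 else r k.1| <= #|V|%:R + 1.
    case: k.2; first by rewrite normr1 lerDr.
    by rewrite /r ger0_norm // ler_wpDr // ler_nat ltnW.
  by apply: le_lt_trans (ler_wpM2l (ltW t0) hk) _; rewrite -ltr_pdivlMr.
split=> [u w nuw|u] /=.
  apply: contraNneq hb2 => h; apply/mapP; exists (u, w); first by rewrite mem_enum.
  have rn : r w - r u != 0.
    rewrite subr_eq0 eqr_nat; apply: contraNneq nuw => /val_inj /enum_rank_inj ->.
    by rewrite eqxx.
  by apply: (mulIf rn); rewrite divfK //=; move: h; lra.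
apply: contraNneq hb1 => h; apply/mapP; exists u; first by rewrite mem_enum.
by move: h; rewrite mulr1; lra.
Qed.

Lemma row_sym z e u b : rig_row z e (u, b) =
  (u == tgt e)%:R * (z (tgt e, b) - sgb (gam e) b * z (src e, b)) +
  (u == src e)%:R * (z (src e, b) - sgb (gam e) b * z (tgt e, b)).
Proof.
have ss : sgb (gam e) b * sgb (gam e) b = 1.
  by case: b => /=; [exact: sg_sqr|rewrite mulr1].
rewrite /rig_row big_bool /del /dcoef !xpair_eqE.
case: b ss => /= ss; rewrite ?andbT ?andbF /= !(mulr0, subr0, addr0, add0r); ring: ss.
Qed.

Definition joins e v o := (src e = v /\ tgt e = o) \/ (src e = o /\ tgt e = v).

Lemma row_joins z e v o u b : joins e v o -> rig_row z e (u, b) =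
  (u == v)%:R * (z (v, b) - sgb (gam e) b * z (o, b)) +
  (u == o)%:R * (z (o, b) - sgb (gam e) b * z (v, b)).
Proof. by case=> [[<- <-]|[<- <-]]; rewrite row_sym 1?addrC. Qed.

Lemma row_loop z e v b : src e = v -> tgt e = v -> gam e = 1 ->
  rig_row z e (v, b) = if b then 4 * z (v, true) else 0.
Proof.
move=> hs ht hg; rewrite row_sym hs ht hg eqxx.
by case: b; rewrite /= ?mul1r ?subrr ?addr0 // /sg /= expr1; ring.
Qed.

Lemma row_eq_endpoints z z' e : (forall b, z (src e, b) = z' (src e, b)) ->
  (forall b, z (tgt e, b) = z' (tgt e, b)) -> rig_row z e = rig_row z' e.
Proof. by move=> h1 h2; apply: funext => -[u b]; rewrite !row_sym h1 h2. Qed.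

Definition avoids H (v : V) := forall e, e \in H -> src e != v /\ tgt e != v.

Definition move_to z v (p : bool -> R) (k : V * bool) := if k.1 == v then p k.2 else z k.

Lemma row_move_to z v p H e : avoids H v -> e \in H -> rig_row (move_to z v p) e = rig_row z e.
Proof.
move=> hH /hH [h1 h2]; apply: row_eq_endpoints => b; rewrite /move_to /=.
  by rewrite (negbTE h1).
by rewrite (negbTE h2).
Qed.

Lemma row_avoids z v H e b : avoids H v -> e \in H -> rig_row z e (v, b) = 0.
Proof. by move=> hH /hH [h1 h2]; apply: row_off; rewrite eq_sym. Qed.

(** Rows of [H] vanish in the columns of [v]: the matrix is block triangular, and the star is tested
    in these two columns. *)
Lemma star_extension z v H D p : avoids H v -> [disjoint H & D] ->
  indep (rig_row z) H ->
  (forall w : E -> R, (forall b, \sum_(e in D) w e * rig_row (move_to z v p) e (v, b) = 0) ->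
     forall e, e \in D -> w e = 0) ->
  indep (rig_row (move_to z v p)) (H :|: D).
Proof.
move=> hH hHD hz hD w hw.
have wD e : e \in D -> w e = 0.
  apply: hD => b; rewrite -[RHS](hw (v, b)) sum_setU // [X in _ = X + _]big1 ?add0r //.
  by move=> f hf; rewrite (row_avoids _ _ hH hf) mulr0.
move=> e'; rewrite in_setU => /orP[]; last exact: wD.
move: e'.
apply: hz => k; rewrite -[RHS](hw k) sum_setU // [X in _ = _ + X]big1 ?addr0.
  by apply: eq_bigr => f hf; rewrite (row_move_to _ _ hH hf).
by move=> f /wD ->; rewrite mul0r.
Qed.

Lemma extend_one_edge z v H e o : avoids H v -> e \notin H -> indep (rig_row z) H ->
  joins e v o -> o != v -> exists z', indep (rig_row z') (e |: H).
Proof.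
move=> hH heH hz hj ov; exists (move_to z v (fun=> z (o, false) + 1)).
rewrite setUC; apply: star_extension => // [|w hw f].
  by rewrite disjoint_sym disjoints1.
move/set1P => ->; have := hw false.
rewrite big_set1 (row_joins _ _ _ hj) eqxx eq_sym (negbTE ov) /move_to /= eqxx (negbTE ov).
by move=> <-; ring.
Qed.

Lemma extend_loop z v H e : avoids H v -> e \notin H -> indep (rig_row z) H ->
  src e = v -> tgt e = v -> gam e = 1 -> exists z', indep (rig_row z') (e |: H).
Proof.
move=> hH heH hz hs ht hg; exists (move_to z v (fun=> 1)).
rewrite setUC; apply: star_extension => // [|w hw f].
  by rewrite disjoint_sym disjoints1.
move/set1P => ->; have := hw true.
rewrite big_set1 (row_loop _ _ hs ht hg) /move_to /= eqxx.
by lra.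
Qed.

Lemma extend_loop_edge z v H l e o : avoids H v -> l \notin H -> e \notin H -> l != e ->
  indep (rig_row z) H -> src l = v -> tgt l = v -> gam l = 1 -> joins e v o -> o != v ->
  exists z', indep (rig_row z') (H :|: [set l; e]).
Proof.
move=> hH hl he hle hz hs ht hg hj ov.
exists (move_to z v (fun b => if b then 1 else z (o, false) + 1)).
apply: star_extension => // [|w hw].
  by rewrite disjoint_sym disjoints_subset subUset !sub1set !in_setC; apply/andP.
have := hw false; have := hw true; rewrite !big_setU1 ?inE //= !big_set1.
rewrite !(row_loop _ _ hs ht hg) !(row_joins _ _ _ hj) eqxx eq_sym (negbTE ov).
rewrite /move_to /= !eqxx (negbTE ov) => h1 h2.
have we : w e = 0 by rewrite -h2; ring.
have wl : w l = 0 by move: h1; rewrite we; lra.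
by move=> f; rewrite !inE => /orP[] /eqP ->.
Qed.

Lemma extend_two_edges z v H e1 e2 o1 o2 : avoids H v -> e1 \notin H -> e2 \notin H ->
  e1 != e2 -> indep (rig_row z) H -> joins e1 v o1 -> joins e2 v o2 -> o1 != v -> o2 != v ->
  (exists b, sgb (gam e1) b * z (o1, b) != sgb (gam e2) b * z (o2, b)) ->
  exists z', indep (rig_row z') (H :|: [set e1; e2]).
Proof.
move=> hH he1 he2 he hz hj1 hj2 ov1 ov2 hq.
pose q1 b := sgb (gam e1) b * z (o1, b); pose q2 b := sgb (gam e2) b * z (o2, b).
pose d b := q1 b - q2 b.
have dn : d false ^+ 2 + d true ^+ 2 != 0.
  apply/negP; rewrite paddr_eq0 ?sqr_ge0 // !sqrf_eq0 !subr_eq0 => /andP[/eqP h1 /eqP h2].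
  by case: hq => -[]; rewrite -/(q1 _) -/(q2 _) ?h1 ?h2 eqxx.
(* The new point is [q1] plus [d] turned by a right angle, so its differences to [q1] and [q2] are
   independent as soon as [d != 0]. *)
exists (move_to z v (fun b => if b then q1 true + d false else q1 false - d true)).
apply: star_extension => // [|w hw].
  by rewrite disjoint_sym disjoints_subset subUset !sub1set !in_setC; apply/andP.
have := hw false; have := hw true; rewrite !big_setU1 ?inE //= !big_set1.
rewrite !(row_joins _ _ _ hj1) !(row_joins _ _ _ hj2) eqxx.
rewrite [v == o1]eq_sym [v == o2]eq_sym (negbTE ov1) (negbTE ov2).
rewrite /move_to /= !eqxx (negbTE ov1) (negbTE ov2) -/(q1 true) -/(q2 true).
rewrite -/(sgb (gam e1) false) -/(sgb (gam e2) false) -/(q1 false) -/(q2 false) => h1 h2.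
have w2 : w e2 = 0.
  apply: (mulIf dn); rewrite mul0r.
  have := congr2 (fun x y => x * d true + y * d false) h1 h2.
  by rewrite /= [in RHS]mul0r [in RHS]mul0r addr0 => h; rewrite -[RHS]h /d; ring.
have w1 : w e1 = 0.
  apply: (mulIf dn); rewrite mul0r; move: h1 h2; rewrite w2 => h1 h2.
  have := congr2 (fun x y => x * d false - y * d true) h1 h2.
  by rewrite /= [in RHS]mul0r [in RHS]mul0r subrr => h; rewrite -[RHS]h /d; ring.
by move=> f; rewrite !inE => /orP[] /eqP ->.
Qed.

End Extension.

(** * Vertices of low degree and the counts around them *)

Section Degree.
Variables (V E : finType) (src tgt : E -> V) (gam : E -> 'Z_2).
Notation VF := (VF src tgt).
Notation joins := (joins src tgt).
Notation avoids := (avoids src tgt).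
Notation sparse := (sparse src tgt gam).
Notation balanced := (balanced src tgt gam).
Notation potential := (potential src tgt gam).
Implicit Types (F H D X : {set E}) (v o : V).

Lemma sparse_sub F H : H \subset F -> sparse F -> sparse H.
Proof. by move=> sHF hF X sX; apply: hF; exact: subset_trans sHF. Qed.

Definition star F v := [set e in F | (src e == v) || (tgt e == v)].
Definition loops F v := [set e in F | (src e == v) && (tgt e == v)].

(** Counting a loop twice, the degrees sum to [2 * #|F| < 4 * #|VF F|]. *)
Lemma exists_low_degree F : sparse F -> F != set0 ->
  exists2 v, v \in VF F & (#|star F v| + #|loops F v| <= 3)%N.
Proof.
move=> hF hn; have [h1 _] := hF F (subxx _) hn.
apply: contrapT => hno.
have hdeg v : v \in VF F -> (4 <= #|star F v| + #|loops F v|)%N.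
  by move=> hv; rewrite leqNgt ltnS; apply/negP => h; apply: hno; exists v.
have : (\sum_(v in VF F) 4 <= \sum_(v in VF F) (#|star F v| + #|loops F v|))%N.
  by apply: leq_sum => v; exact: hdeg.
rewrite sum_nat_const.
have -> : (\sum_(v in VF F) (#|star F v| + #|loops F v|) =
    \sum_(v in VF F) \sum_(e in F) ((src e == v) + (tgt e == v)))%N.
  apply: eq_bigr => v _; rewrite -!sum1dep_card !big_mkcondr -big_split /=.
  by apply: eq_bigr => e _; case: (_ == v); case: (_ == v).
have sum_eq x : x \in VF F -> (\sum_(v in VF F) (x == v) = 1)%N.
  move=> hx; rewrite (bigD1 x) //= eqxx big1 ?addn0 // => v /andP[_].
  by rewrite eq_sym => /negbTE ->.
rewrite exchange_big /= (eq_bigr (fun=> 2%N)); last first.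
  by move=> e /(mem_VF src tgt) [hs ht]; rewrite big_split /= !sum_eq.
by rewrite sum_nat_const; card_lia.
Qed.

Lemma VF_star_bound X D v : v \notin VF X -> {subset VF D <= v |: VF X} ->
  (#|VF (X :|: D)| <= #|VF X|.+1)%N.
Proof.
move=> hv hD; rewrite VFU; apply: (@leq_trans #|v |: VF X|).
  by apply: subset_leq_card; rewrite subUset subsetUr; apply/subsetP.
by rewrite cardsU1 hv.
Qed.

Lemma joins_mem e v o u : joins e v o -> (src e = u \/ tgt e = u) -> u = v \/ u = o.
Proof. by case=> [[<- <-]|[<- <-]] [] <-; [left|right|right|left]. Qed.

Lemma not_mem_VF_avoids H v : avoids H v -> v \notin VF H.
Proof. by move=> hH; apply/VFP => -[e /hH [/eqP h1 /eqP h2] []]. Qed.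

Lemma avoids_sub H X v : X \subset H -> avoids H v -> avoids X v.
Proof. by move=> /subsetP h hH e /h; apply: hH. Qed.

Lemma joins_loopless F v e : e \in star F v -> e \notin loops F v ->
  exists2 o, joins e v o & o != v.
Proof.
rewrite !inE => /andP[-> /=]; have [h _|h1 /= h2 _] := eqVneq (src e) v.
  by move=> /= h'; exists (tgt e) => //; left.
exists (src e) => //; right; split=> //; exact/eqP.
Qed.

Section Star.
Variables (F : {set E}) (hF : sparse F) (v : V).

Lemma sparse_loop e : e \in F -> src e = v -> tgt e = v -> gam e = 1.
Proof.
move=> he hs ht; have [||_ h] := hF (X := [set e]); first by rewrite sub1set.
  by apply/set0Pn; exists e; rewrite inE.
have VE : VF [set e] = [set v].
  apply/setP => u; rewrite [RHS]inE; apply/VFP/eqP => [[f /set1P ->]|->].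
    by rewrite hs ht => -[].
  by exists e; rewrite ?inE //; left.
rewrite VE !cards1 in h; apply: contrapT => hg.
have g0 : gam e = 0 by apply/val_inj; move: hg; case: (gam e) => -[|[|//]] // i [];
  apply/val_inj.
suff /h : balanced [set e] by [].
by exists (fun=> 0) => f /set1P ->; rewrite addr0.
Qed.

Lemma sparse_loops_card : (#|loops F v| <= 1)%N.
Proof.
have [->|hn] := eqVneq (loops F v) set0; first by rewrite cards0.
have sl : loops F v \subset F by apply/subsetP => e; rewrite inE => /andP[].
have [h _] := hF sl hn.
have : (#|VF (loops F v)| <= 1)%N.
  rewrite -(cards1 v); apply: subset_leq_card; apply/subsetP => u /VFP [e].
  by rewrite !inE => /andP[_ /andP[/eqP -> /eqP ->]] [] ->.
card_lia.
Qed.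

Lemma sparse_parallel e f o : e \in F -> f \in F -> e != f -> joins e v o -> joins f v o ->
  o != v -> gam e != gam f.
Proof.
move=> he hf hef je jf ov; apply/eqP => hg.
have [||_ h] := hF (X := [set e; f]); first by rewrite subUset !sub1set he.
  by apply/set0Pn; exists e; rewrite !inE eqxx.
have VE : VF [set e; f] \subset [set v; o].
  apply/subsetP => u /VFP [g]; rewrite !inE => hg' hu.
  have : u = v \/ u = o by case/orP: hg' => /eqP hg'; rewrite hg' in hu;
    [exact: joins_mem je hu|exact: joins_mem jf hu].
  by case=> ->; rewrite eqxx ?orbT.
have := subset_leq_card VE; rewrite cards2 eq_sym ov => hc.
rewrite cards2 hef in h; suff /h : balanced [set e; f] by card_lia.
exists (fun u => if u == o then gam e else 0) => g; rewrite !inE => /orP[] /eqP ->.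
  by case: je => -[-> ->]; rewrite eqxx eq_sym (negbTE ov) ?addr0 ?add0r.
by case: jf => -[-> ->]; rewrite eqxx eq_sym (negbTE ov) ?addr0 ?add0r.
Qed.

Variables (e1 e2 e3 : E) (o1 o2 o3 : V) (H : {set E}).
Hypotheses (n12 : e1 != e2) (n13 : e1 != e3) (n23 : e2 != e3).
Hypotheses (j1 : joins e1 v o1) (j2 : joins e2 v o2) (j3 : joins e3 v o3).
Hypotheses (v1 : o1 != v) (v2 : o2 != v) (v3 : o3 != v).
Hypotheses (he1 : e1 \in F) (he2 : e2 \in F) (he3 : e3 \in F).
Hypotheses (sHF : H \subset F) (hH : avoids H v).

Let D := [set e1; e2; e3].

Let cardD : #|D| = 3.
Proof. by rewrite /D setUC cardsU1 !inE cards2 eq_sym (negbTE n13) eq_sym (negbTE n23) n12. Qed.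

Let avoids_not_mem X e o : X \subset H -> joins e v o -> e \notin X.
Proof.
move=> sX je; apply/negP => /(subsetP sX) /hH [/eqP h1 /eqP h2].
by case: je => -[].
Qed.

Let star_cards X : X \subset H -> o1 \in VF X -> o2 \in VF X -> o3 \in VF X ->
  [/\ X :|: D \subset F, X :|: D != set0, #|X :|: D| = (#|X| + 3)%N
    & (#|VF (X :|: D)| <= #|VF X|.+1)%N].
Proof.
move=> sX h1 h2 h3; split.
- by rewrite subUset (subset_trans sX sHF) !subUset !sub1set he1 he2 he3.
- by apply/set0Pn; exists e1; rewrite !inE eqxx ?orbT.
- rewrite cardsU cardD; have -> : X :&: D = set0; last by rewrite cards0 subn0.
  apply/setP => e; rewrite !inE; apply/negP => /andP[heX /orP[/orP[]|] /eqP ee];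
    move: heX; rewrite ee; apply/negP;
    [exact: avoids_not_mem j1|exact: avoids_not_mem j2|exact: avoids_not_mem j3].
- apply: (@VF_star_bound _ _ v).
    exact/not_mem_VF_avoids/(avoids_sub sX hH).
  move=> u /VFP [e]; rewrite !inS => /orP[/orP[]|] /eqP -> hu.
  + by case: (joins_mem j1 hu) => ->; rewrite ?eqxx ?h1 ?orbT.
  + by case: (joins_mem j2 hu) => ->; rewrite ?eqxx ?h2 ?orbT.
  + by case: (joins_mem j3 hu) => ->; rewrite ?eqxx ?h3 ?orbT.
Qed.

(** [v] and its three edges add 3 on the left and at most 2 on the right, which accounts for the
    slack 2 here and 4 in the balanced case. *)
Lemma sparse_deg3_unbalanced : deg3_unbalanced src tgt H o1 o2 o3.
Proof.
move=> X sX h1 h2 h3; have [s1 s2 s3 s4] := star_cards sX h1 h2 h3.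
by have [] := hF s1 s2; card_lia.
Qed.

Lemma sparse_deg3_balanced :
  deg3_balanced src tgt gam H o1 o2 o3 (gam e1) (gam e2) (gam e3).
Proof.
move=> X s sX pX h1 h2 h3 g1 g2 g3; have [s1 s2 s3 s4] := star_cards sX h1 h2 h3.
have [_ h] := hF s1 s2; suff /h : balanced (X :|: D) by card_lia.
(* With value 0 at [v], the edge [e1] requires exactly [s o1 = gam e1], and likewise for the other
   two. *)
exists (fun u => if u == v then 0 else s u) => e; rewrite in_setU => /orP[heX|].
  have [/negbTE -> /negbTE ->] := hH (subsetP sX _ heX); exact: pX.
have jE f o : joins f v o -> o != v -> s o = gam f ->
    gam f = (if tgt f == v then 0 else s (tgt f)) + (if src f == v then 0 else s (src f)).
  by case=> -[-> ->] /negbTE ->; rewrite eqxx ?addr0 ?add0r.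
by rewrite !inE => /orP[/orP[]|] /eqP ->; [apply: jE j1 v1 g1|apply: jE j2 v2 g2|apply: jE j3 v3 g3].
Qed.

End Star.

End Degree.

Definition upd (E : eqType) (T : Type) (f : E -> T) (e : E) (x : T) :=
  fun e' => if e' == e then x else f e'.

Lemma addKr_Z2 (a b : 'Z_2) : a + b + a = b.
Proof. by rewrite addrC addrA addrr_Z2 add0r. Qed.

Lemma addr_eq0_Z2 (a b : 'Z_2) : a + b = 0 -> a = b.
Proof. by move=> h; rewrite -(addKr_Z2 b a) [b + a]addrC h add0r. Qed.

(** * Redirecting an edge at the removed vertex between two of its neighbors *)

Section Replace.
Variables (V E : finType) (src tgt : E -> V) (gam : E -> 'Z_2).
Variables (H : {set E}) (e1 : E) (o1 o2 : V) (c1 c2 : 'Z_2).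
Hypotheses (hs : sparse src tgt gam H) (he1 : e1 \notin H).
Implicit Types X Y : {set E}.
Notation src' := (upd src e1 o1).
Notation tgt' := (upd tgt e1 o2).
Notation gam' := (upd gam e1 (c1 + c2)).

Lemma upd_neq (T : Type) (f : E -> T) (x : T) (e : E) : e \in H -> upd f e1 x e = f e.
Proof. by rewrite /upd; case: eqP he1 => // -> /negP. Qed.

Lemma VF_upd X : X \subset H -> VF src' tgt' X = VF src tgt X.
Proof.
move=> /subsetP sX; apply/setP => v.
by apply/VFP/VFP => -[e he hv]; exists e; rewrite // ?upd_neq ?sX // in hv *.
Qed.

Lemma VF_upd1 X : X \subset H -> VF src' tgt' (e1 |: X) = [set o1; o2] :|: VF src tgt X.
Proof.
move=> sX; rewrite VFU (VF_upd sX); congr (_ :|: _); apply/setP => v.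
apply/VFP/set2P => [[e /set1P ->]|h].
  by rewrite /upd eqxx; case=> ->; [left|right].
by exists e1; rewrite ?inE // /upd eqxx; case: h => ->; [left|right].
Qed.

(** A violating set contains the new edge; without it, it is tight with both ends among its
    vertices, hence a blocker. *)
Lemma unblocked_sparse : (o1 = o2 -> c1 != c2) ->
  ~ blocked src tgt gam H o1 c1 o2 c2 -> sparse src' tgt' gam' (e1 |: H).
Proof.
move=> ho hb X sX hX.
have sYH : X :\ e1 \subset H by rewrite subDset.
have eq_card_VF Y : Y \subset H -> (#|[set o1; o2] :|: VF src tgt Y| <= #|VF src tgt Y|)%N ->
    o1 \in VF src tgt Y /\ o2 \in VF src tgt Y.
  move=> sY hc; have : VF src tgt Y == [set o1; o2] :|: VF src tgt Y.
    by rewrite eqEcard subsetUr.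
  by move/eqP => ->; rewrite !inS !eqxx ?orbT.
case: (boolP (e1 \in X)) => heX; last first.
  have sX' : X \subset H by move: sYH; rewrite (setDidPl _) // disjoint_sym disjoints1.
  have [h1 h2] := hs sX' hX; rewrite VF_upd //; split=> // -[s ps]; apply: h2; exists s.
  move=> e he; have := ps e he; have := subsetP sX' e he => h; by rewrite !upd_neq.
have XE : X = e1 |: (X :\ e1) by rewrite setD1K.
move: (X :\ e1) XE sYH => Y XE sY.
have he1Y : e1 \notin Y by apply: contra he1; apply: (subsetP sY).
have cX : #|X| = #|Y|.+1 by rewrite XE cardsU1 he1Y.
have o1W : (0 < #|[set o1; o2] :|: VF src tgt Y|)%N.
  by apply/card_gt0P; exists o1; rewrite !inS eqxx.
have mono : (#|VF src tgt Y| <= #|[set o1; o2] :|: VF src tgt Y|)%N.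
  by apply: subset_leq_card; rewrite subsetUr.
rewrite cX {1 3}XE VF_upd1 //; split.
  have [Y0|hY] := eqVneq Y set0; first by move: o1W; rewrite Y0 cards0; card_lia.
  rewrite leqNgt; apply/negP => hlt.
  have hY1 := sparse_card hs sY hY.
  have hc : (#|[set o1; o2] :|: VF src tgt Y| <= #|VF src tgt Y|)%N by card_lia.
  have [h1 h2] := eq_card_VF _ sY hc.
  by apply: hb; left; exists Y; split=> //; card_lia.
move=> [s ps].
have pY : potential src tgt gam Y s.
  move=> e he; have := ps e; rewrite XE in_setU1 he orbT !upd_neq ?(subsetP sY) //.
  exact.
have g1 : c1 + c2 = s o2 + s o1.
  by have := ps e1; rewrite XE in_setU1 eqxx /upd eqxx; apply.
(* A loop would have color 0 by balance, but [c1 != c2] when [o1 = o2]. *)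
have n12 : o1 != o2.
  apply/eqP => ho12; move: g1; rewrite ho12 addrr_Z2 => /addr_eq0_Z2 /eqP.
  by apply/negP/ho.
have W2 : (2 <= #|[set o1; o2] :|: VF src tgt Y|)%N.
  have := subset_leq_card (subsetUl [set o1; o2] (VF src tgt Y)).
  by rewrite cards2 n12.
have [Y0|hY] := eqVneq Y set0; first by move: W2; rewrite Y0 cards0; card_lia.
rewrite leqNgt; apply/negP => hlt.
have hY1 := sparse_balanced_card hs sY pY hY.
have hc : (#|[set o1; o2] :|: VF src tgt Y| <= #|VF src tgt Y|)%N by card_lia.
have [h1 h2] := eq_card_VF _ sY hc.
(* A potential may be shifted by a constant; this shift gives the value [c1] at [o1], and then [c2]
   at [o2]. *)
apply: hb; right; exists Y, (fun v => s v + (s o1 + c1)); split; split => //.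
- move=> e he; rewrite (pY e he) addrACA.
  by rewrite addrr_Z2 addr0.
- by rewrite addrA addrr_Z2 add0r.
- by rewrite addrA -g1 addKr_Z2.
- card_lia.
Qed.

End Replace.

(** * Independence after a 1-extension *)

Section OneExtension.
Variables (R : realType) (V E : finType) (src tgt : E -> V) (gam : E -> 'Z_2).
Notation rig_row := (@rig_row R V E).
Notation sgb := (sgb R).
Variables (H : {set E}) (v o1 o2 o3 : V) (e1 e2 e3 : E).
Hypotheses (hH : avoids src tgt H v).
Hypotheses (n12 : e1 != e2) (n13 : e1 != e3) (n23 : e2 != e3).
Hypotheses (h1H : e1 \notin H) (h2H : e2 \notin H) (h3H : e3 \notin H).
Hypotheses (j1 : joins src tgt e1 v o1) (j2 : joins src tgt e2 v o2) (j3 : joins src tgt e3 v o3).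
Hypotheses (v1 : o1 != v) (v2 : o2 != v) (v3 : o3 != v).
Implicit Types X Y : {set E}.
Notation src' := (upd src e1 o1).
Notation tgt' := (upd tgt e1 o2).
Notation gam' := (upd gam e1 (gam e1 + gam e2)).

(** Coordinates of the lift [(o, gam e)], the neighbor of [(v, 0)] across [e]. *)
Definition nbr (z : V * bool -> R) e o b := sgb (gam e) b * z (o, b).

(** Twice the signed area of the triangle of the three neighbors. *)
Definition collinearity z :=
  (nbr z e2 o2 false - nbr z e1 o1 false) * (nbr z e3 o3 true - nbr z e1 o1 true) -
  (nbr z e3 o3 false - nbr z e1 o1 false) * (nbr z e2 o2 true - nbr z e1 o1 true).

Lemma sgb_sqr c b : sgb c b * sgb c b = 1.
Proof. by case: b => /=; [exact: sg_sqr|rewrite mulr1]. Qed.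

Lemma sgbD c c' b : sgb (c + c') b = sgb c b * sgb c' b.
Proof. by case: b => /=; [exact: sgD|rewrite mulr1]. Qed.

Lemma row_midpoint z u b : u != v ->
  let z' := move_to z v (fun b => 2^-1 * (nbr z e1 o1 b + nbr z e2 o2 b)) in
  rig_row src tgt gam z' e1 (u, b) + rig_row src tgt gam z' e2 (u, b) =
  2^-1 * rig_row src' tgt' gam' z e1 (u, b).
Proof.
move=> uv z'.
rewrite (row_joins _ _ _ _ j1) (row_joins _ _ _ _ j2) (negbTE uv) !mul0r !add0r.
rewrite row_sym /upd eqxx sgbD /z' /move_to /= eqxx (negbTE v1) (negbTE v2) /nbr.
have := sgb_sqr (gam e1) b; have := sgb_sqr (gam e2) b.
move: (sgb (gam e1) b) (sgb (gam e2) b) => s1 s2 h2 h1.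
by field: h1 h2.
Qed.

(** Put [v] at the midpoint of the first two neighbors. There [e1] and [e2] have opposite
    directions, so the columns of [v] and noncollinearity give [w e3 = 0] and [w e1 = w e2]; by
    [row_midpoint] the rest is a relation of the reduced graph. *)
Lemma one_extension z : indep (rig_row src' tgt' gam' z) (e1 |: H) -> collinearity z != 0 ->
  exists z', indep (rig_row src tgt gam z') (H :|: [set e1; e2; e3]).
Proof.
move=> hz hcol.
pose z' := move_to z v (fun b => 2^-1 * (nbr z e1 o1 b + nbr z e2 o2 b)).
exists z' => w hw.
pose D := [set e1; e2; e3].
have hHD : [disjoint H & D].
  by rewrite disjoint_sym disjoints_subset !subUset !sub1set !in_setC h1H h2H.
have sumD (f : E -> R) : \sum_(e in D) f e = f e1 + f e2 + f e3.
  rewrite /D -setUA big_setU1 ?big_setU1 ?big_set1 ?inE ?negb_or ?n12 ?n13 //=.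
  by rewrite addrA.
have hv b : w e1 * (z' (v, b) - nbr z e1 o1 b) + w e2 * (z' (v, b) - nbr z e2 o2 b) +
    w e3 * (z' (v, b) - nbr z e3 o3 b) = 0.
  rewrite -[RHS](hw (v, b)) sum_setU // [X in _ = X + _]big1 ?add0r.
    rewrite sumD (row_joins _ _ _ _ j1) (row_joins _ _ _ _ j2) (row_joins _ _ _ _ j3).
    rewrite eqxx [v == o1]eq_sym [v == o2]eq_sym [v == o3]eq_sym.
    rewrite (negbTE v1) (negbTE v2) (negbTE v3) !mul0r !addr0 !mul1r /nbr.
    by rewrite /z' /move_to /= (negbTE v1) (negbTE v2) (negbTE v3).
  by move=> e he; rewrite (row_avoids _ _ _ hH he) mulr0.
have zv b : z' (v, b) = 2^-1 * (nbr z e1 o1 b + nbr z e2 o2 b).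
  by rewrite /z' /move_to /= eqxx.
have w3 : w e3 = 0.
  apply: (mulIf hcol); rewrite mul0r.
  have := congr2 (fun x y => x * (nbr z e2 o2 true - nbr z e1 o1 true) -
    y * (nbr z e2 o2 false - nbr z e1 o1 false)) (hv false) (hv true).
  rewrite /= !zv [in RHS]mul0r [in RHS]mul0r subrr => h; rewrite -[RHS]h /collinearity.
  by field.
have w12 : w e1 = w e2.
  apply/eqP; rewrite -subr_eq0; apply/eqP; apply: (mulIf hcol); rewrite mul0r.
  have hb b : (w e1 - w e2) * (nbr z e2 o2 b - nbr z e1 o1 b) = 0.
    by rewrite -[RHS](mulr0 2) -(hv b) w3 zv; field.
  have := congr2 (fun x y => x * (nbr z e3 o3 true - nbr z e1 o1 true) -
    y * (nbr z e3 o3 false - nbr z e1 o1 false)) (hb false) (hb true).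
  rewrite /= [in RHS]mul0r [in RHS]mul0r subrr => h; rewrite -[RHS]h /collinearity.
  by ring.
pose w' e := if e == e1 then 2^-1 * w e1 else w e.
have hw' : forall e, e \in e1 |: H -> w' e = 0.
  apply: hz => -[u b]; rewrite big_setU1 //= {1}/w' eqxx.
  have hsum : \sum_(e in H) w' e * rig_row src' tgt' gam' z e (u, b) =
      \sum_(e in H) w e * rig_row src tgt gam z e (u, b).
    apply: eq_bigr => e he; rewrite /w' (negbTE (_ : e != e1)); last first.
      by apply: contraNneq h1H => <-.
    by rewrite !row_sym !(upd_neq h1H).
  rewrite hsum; have [->|uv] := eqVneq u v.
    rewrite [X in _ + X]big1 => [|e he]; last by rewrite (row_avoids _ _ _ hH he) mulr0.
    rewrite addr0 row_sym /upd eqxx [v == o2]eq_sym [v == o1]eq_sym.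
    by rewrite (negbTE v1) (negbTE v2) !mul0r addr0 mulr0.
  rewrite -[RHS](hw (u, b)) sum_setU // sumD w3 mul0r addr0 -w12 -mulrDr addrC.
  rewrite row_midpoint //; congr (_ + _); last by ring.
  by apply: eq_bigr => e he; rewrite (row_move_to _ _ _ hH he).
have we1 : w e1 = 0.
  have := hw' e1 (setU11 _ _); rewrite /w' eqxx => /eqP.
  by rewrite mulf_eq0 invr_eq0 pnatr_eq0 /= => /eqP.
move=> e; rewrite !inS => /orP[he|/orP[/orP[]|] /eqP ->] //; last by rewrite -w12.
have := hw' e (setU1r _ he); rewrite /w' (negbTE (_ : e != e1)) //.
by apply: contraNneq h1H => <-.
Qed.

(** Coinciding neighbors have different colors, so their lifts are mirror images and the third point
    is off their line; three cannot coincide with two colors. For distinct neighbors, moving [o3]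
    across the mirror changes the determinant at a nonzero rate. Independence refers to a separate
    graph because it is that of the reduced one. *)
Lemma exists_noncollinear z (F : {set E}) (src0 tgt0 : E -> V) (gam0 : E -> 'Z_2) :
  (o1 = o2 -> gam e1 != gam e2) -> (o1 = o3 -> gam e1 != gam e3) ->
  (o2 = o3 -> gam e2 != gam e3) ->
  indep (rig_row src0 tgt0 gam0 z) F ->
  exists2 z', indep (rig_row src0 tgt0 gam0 z') F & collinearity z' != 0.
Proof.
move=> g12 g13 g23 /indep_general_position [{}z hz [gx gy]].
have sgN (a c : 'Z_2) : a != c -> sg R a = - sg R c.
  by rewrite /sg; case: a c => -[|[|//]] i [[|[|//]] j] //; rewrite expr0 expr1 ?opprK.
have sg0 c : sg R c != 0 by rewrite /sg signr_eq0.
have Z2P (a c d : 'Z_2) : a != c -> a != d -> c != d -> False.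
  by case: a c d => -[|[|//]] i [[|[|//]] j] [[|[|//]] k].
have x_neq u w : u != w -> z (u, false) - z (w, false) != 0.
  by move=> /gx; rewrite subr_eq0.
have [e12|d12] := eqVneq o1 o2.
  have d31 : o3 != o1.
    apply/eqP => h; apply: (Z2P (gam e1) (gam e2) (gam e3)); [exact: g12|exact: g13|].
    by apply: g23; rewrite -e12 h.
  exists z => //; rewrite /collinearity /nbr /= -e12 (sgN _ _ (g12 e12)).
  set X := (X in X != 0); have -> : X = - (z (o3, false) - z (o1, false)) *
      (2 * (sg R (gam e2) * z (o1, true))) by rewrite /X; ring.
  by rewrite !mulf_neq0 ?oppr_eq0 ?pnatr_eq0 ?x_neq.
have [e13|d13] := eqVneq o1 o3.
  exists z => //; rewrite /collinearity /nbr /= -e13 (sgN _ _ (g13 e13)).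
  set X := (X in X != 0); have -> : X = (z (o2, false) - z (o1, false)) *
      (2 * (sg R (gam e3) * z (o1, true))) by rewrite /X; ring.
  by rewrite !mulf_neq0 ?oppr_eq0 ?pnatr_eq0 ?x_neq // eq_sym.
have [e23|d23] := eqVneq o2 o3.
  exists z => //; rewrite /collinearity /nbr /= -e23 (sgN _ _ (g23 e23)).
  set X := (X in X != 0); have -> : X = (z (o2, false) - z (o1, false)) *
      (2 * (sg R (gam e3) * z (o2, true))) by rewrite /X; ring.
  by rewrite !mulf_neq0 ?oppr_eq0 ?pnatr_eq0 ?x_neq // eq_sym.
have [c0|cn] := eqVneq (collinearity z) 0; last by exists z.
have [eps eps0 hopen] := indep_row_open hz.
pose z' (k : V * bool) := z k + (if k == (o3, true) then eps / 2 else 0).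
exists z'.
  apply: hopen => k; rewrite /z' addrC addKr; case: ifP => _; last by rewrite normr0.
  by rewrite gtr0_norm; lra.
have -> : collinearity z' = collinearity z +
    (z (o2, false) - z (o1, false)) * (sg R (gam e3) * (eps / 2)).
  rewrite /collinearity /nbr /z' /= !xpair_eqE !andbF !andbT eqxx.
  by rewrite (negbTE d13) (negbTE d23) !addr0; ring.
rewrite c0 add0r !mulf_neq0 ?x_neq ?invr_eq0 ?pnatr_eq0 //; first by rewrite eq_sym.
by rewrite gt_eqF.
Qed.

End OneExtension.

Section Henneberg.
Variables (R : realType) (V E : finType).
Notation rig_row := (@rig_row R V E).

(* Henneberg induction. Undoing a 1-extension at v keeps the set of edges E: the edge e1
   is redirected by upd to become the new edge between two neighbors of v. *)
Lemma sparse_generic_indep n (src tgt : E -> V) (gam : E -> 'Z_2) (F : {set E}) :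
  (#|F| <= n)%N -> sparse src tgt gam F -> exists z, indep (rig_row src tgt gam z) F.
Proof.
elim: n src tgt gam F => [|n IH] src tgt gam F.
  rewrite leqn0 cards_eq0 => /eqP -> _; exists (fun=> 0) => w _ e.
  by rewrite inE.
move=> hn hF; have [F0|hF0] := eqVneq F set0.
  by rewrite F0; exists (fun=> 0) => w _ e; rewrite inE.
have [v hv hdeg] := exists_low_degree hF hF0.
set S := star src tgt F v in hdeg; set L := loops src tgt F v in hdeg.
have sSF : S \subset F by apply/subsetP => e; rewrite inE => /andP[].
have sLS : L \subset S.
  by apply/subsetP => e; rewrite !inE => /andP[-> /andP[-> _]].
pose H := F :\: S.
have FE : F = H :|: S by rewrite -{1}(setID F S) (setIidPr sSF) setUC.
have sHF : H \subset F by exact: subsetDl.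
have hH : avoids src tgt H v.
  move=> e; rewrite !inE => /andP[h1 h2]; move: h1.
  by rewrite h2 /= negb_or => /andP.
have HS e : e \in S -> e \notin H by rewrite in_setD => ->.
have sH : sparse src tgt gam H by exact: sparse_sub sHF hF.
have S0 : (0 < #|S|)%N.
  case/VFP: hv => e he hev; apply/card_gt0P; exists e; rewrite inE he.
  by case: hev => ->; rewrite eqxx ?orbT.
have cF : #|F| = (#|H| + #|S|)%N.
  by rewrite addnC -(cardsID S F) (setIidPr sSF).
have [z0 hz0] : exists z, indep (rig_row src tgt gam z) H.
  by apply: IH sH; card_lia.
have [z hz [gx gy]] := indep_general_position hz0.
have hL1 := sparse_loops_card hF v.
have joinsS e : e \in S -> e \notin L -> exists2 o, joins src tgt e v o & o != v.
  exact: joins_loopless.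
(* A loop counts twice in the degree, so it leaves room for at most one further edge at [v]. *)
have [L0|/set0Pn [l hl]] := eqVneq L set0; last first.
  have [lF ls lt] : [/\ l \in F, src l = v & tgt l = v].
    by move: hl; rewrite inE => /andP[? /andP[/eqP ? /eqP ?]].
  have lS := subsetP sLS l hl.
  have lg := sparse_loop hF lF ls lt.
  have cS : #|S| = #|S :\ l|.+1 by rewrite (cardsD1 l S) lS.
  have L_gt0 : (0 < #|L|)%N by apply/card_gt0P; exists l.
  have SE : S = l |: (S :\ l) by rewrite setD1K.
  have [S1|/set0Pn [e he]] := eqVneq (S :\ l) set0.
    rewrite FE SE S1 setU0 setUC.
    exact: (extend_loop hH (HS _ lS) hz ls lt lg).
  have [el eS] : e != l /\ e \in S by move: he; rewrite in_setD1 => /andP.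
  have SE2 : S :\ l = [set e].
    apply/esym/eqP; rewrite eqEcard sub1set he cards1; card_lia.
  have eL : e \notin L.
    apply/negP => eL; have : (1 < #|L|)%N.
      by rewrite (cardsD1 l) hl (cardsD1 e) in_setD1 el eL.
    by rewrite ltnNge hL1.
  have [o jo ov] := joinsS e eS eL.
  rewrite FE SE SE2; apply: (extend_loop_edge hH (HS _ lS) (HS _ eS) _ hz ls lt lg jo ov).
  by rewrite eq_sym.
have {}joinsS e : e \in S -> exists2 o, joins src tgt e v o & o != v.
  by move=> he; apply: joinsS => //; rewrite L0 inE.
have S3 : (#|S| <= 3)%N by card_lia.
have inF e : e \in S -> e \in F by exact: (subsetP sSF).
have par e f o : e \in S -> f \in S -> e != f -> joins src tgt e v o ->
    joins src tgt f v o -> o != v -> gam e != gam f.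
  by move=> /inF he /inF hf; exact: sparse_parallel hF _ _ _ _ he hf.
case/card_gt0P: S0 => e1 he1; have [o1 j1 v1] := joinsS e1 he1.
have cS : #|S| = #|S :\ e1|.+1 by rewrite (cardsD1 e1 S) he1.
have SE : S = e1 |: (S :\ e1) by rewrite setD1K.
have [S1|/set0Pn [e2 he2']] := eqVneq (S :\ e1) set0.
  rewrite FE SE S1 setU0 setUC.
  exact: (extend_one_edge hH (HS _ he1) hz j1 v1).
have [n21 he2] : e2 != e1 /\ e2 \in S by move: he2'; rewrite in_setD1 => /andP.
have n12 : e1 != e2 by rewrite eq_sym.
have [o2 j2 v2] := joinsS e2 he2.
have cS2 : #|S :\ e1| = #|S :\ e1 :\ e2|.+1 by rewrite (cardsD1 e2 (S :\ e1)) he2'.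
have SE2 : S = [set e1; e2] :|: (S :\ e1 :\ e2) by rewrite -setUA setD1K.
have g12 : o1 = o2 -> gam e1 != gam e2.
  by move=> o12; apply: (par e1 e2 o1) => //; rewrite o12.
have [S2|/set0Pn [e3 he3']] := eqVneq (S :\ e1 :\ e2) set0.
  rewrite FE SE2 S2 setU0.
  apply: (extend_two_edges hH (HS _ he1) (HS _ he2) n12 hz j1 j2 v1 v2).
  have [o12|o12] := eqVneq o1 o2; last by exists false; rewrite !mul1r gx.
  exists true; rewrite -o12 (inj_eq (mulIf (gy _))) /=.
  have := g12 o12; rewrite /sg.
  by case: (gam e1) (gam e2) => -[|[|//]] i [[|[|//]] j] //= _; rewrite ?expr1 ?expr0;
    rewrite -subr_eq0 ?opprK -?opprD ?oppr_eq0 -(natrD _ 1 1) pnatr_eq0.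
have [n32 n31 he3] : [/\ e3 != e2, e3 != e1 & e3 \in S].
  by move: he3'; rewrite !in_setD1 => /and3P.
have [o3 j3 v3] := joinsS e3 he3.
have SE3 : S = [set e1; e2; e3].
  rewrite {1}SE2; congr (_ :|: _); apply/esym/eqP; rewrite eqEcard sub1set he3' cards1.
  card_lia.
have n13 : e1 != e3 by rewrite eq_sym.
have n23 : e2 != e3 by rewrite eq_sym.
have g13 : o1 = o3 -> gam e1 != gam e3.
  by move=> o13; apply: (par e1 e3 o1) => //; rewrite o13.
have g23 : o2 = o3 -> gam e2 != gam e3.
  by move=> o23; apply: (par e2 e3 o2) => //; rewrite o23.
have hU := sparse_deg3_unbalanced hF n12 n13 n23 j1 j2 j3
  (inF _ he1) (inF _ he2) (inF _ he3) sHF hH.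
have hB := sparse_deg3_balanced hF n12 n13 n23 j1 j2 j3 v1 v2 v3
  (inF _ he1) (inF _ he2) (inF _ he3) sHF hH.
(* Stated for any order of the three edges: [a] becomes the new edge between [oa] and [ob], and [c]
   is the third one. *)
have step a b c oa ob oc : a != b -> a != c -> b != c ->
    joins src tgt a v oa -> joins src tgt b v ob -> joins src tgt c v oc ->
    oa != v -> ob != v -> oc != v -> a \in S -> b \in S -> c \in S ->
    (oa = ob -> gam a != gam b) -> (oa = oc -> gam a != gam c) ->
    (ob = oc -> gam b != gam c) -> S = [set a; b; c] ->
    ~ blocked src tgt gam H oa (gam a) ob (gam b) -> exists z, indep (rig_row src tgt gam z) F.
  move=> nab nac nbc ja jb jc va vb vc ha hb hc gab gac gbc SE' hbl.
  have hs := unblocked_sparse sH (HS _ ha) gab hbl.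
  have [|z1 hz1] := IH _ _ _ _ _ hs.
    rewrite cardsU1 (HS _ ha); have : #|S| = 3.
      by rewrite SE' setUC cardsU1 !inE cards2 eq_sym (negbTE nac) eq_sym (negbTE nbc) nab.
    card_lia.
  have [z2 hz2 hcol] := exists_noncollinear gab gac gbc hz1.
  rewrite FE SE'.
  exact: (one_extension hH nab nac nbc (HS _ ha) (HS _ hb) (HS _ hc) ja jb jc va vb vc hz2 hcol).
have [b12|] := pselect (blocked src tgt gam H o1 (gam e1) o2 (gam e2)); last first.
  by apply: (step e1 e2 e3 o1 o2 o3).
have [b13|] := pselect (blocked src tgt gam H o1 (gam e1) o3 (gam e3)); last first.
  apply: (step e1 e3 e2 o1 o3 o2) => //; first by move/esym; rewrite eq_sym.
  by rewrite SE3 setUAC.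
have [b23|] := pselect (blocked src tgt gam H o2 (gam e2) o3 (gam e3)); last first.
  apply: (step e2 e3 e1 o2 o3 o1) => //.
  - by move/esym; rewrite eq_sym.
  - by move/esym; rewrite eq_sym.
  - by rewrite SE3 -setUA setUC.
by case: (not_all_blocked sH hU hB g12 g13 g23 b12 b13 b23).
Qed.

End Henneberg.

(** * Reflection-Laman graphs and sparsity *)

Section Homology.
Variables (V E : finType) (src tgt : E -> V) (gam : E -> 'Z_2).
Notation VF := (VF src tgt).
Notation adj := (adjF src tgt).
Notation comps := (comps src tgt).
Notation compE := (compE src).
Notation rho := (rho gam).
Notation trivial_rho := (trivial_rho src tgt gam).
Notation balanced := (balanced src tgt gam).
Notation potential := (potential src tgt gam).
Implicit Types (S F X : {set E}) (z : E -> int).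

Definition boundary z (v : V) : int :=
  \sum_(e | tgt e == v) z e - \sum_(e | src e == v) z e.

Definition chain S z := forall e, e \notin S -> z e = 0.

Lemma rhoD z z' : rho (fun e => z e + z' e) = rho z + rho z'.
Proof. by rewrite /rho -big_split; apply: eq_bigr => e _; rewrite intrD mulrDl. Qed.

Lemma rhoN z : rho (fun e => - z e) = - rho z.
Proof. by rewrite /rho -sumrN; apply: eq_bigr => e _; rewrite mulrNz mulNr. Qed.

Lemma boundaryD z z' v : boundary (fun e => z e + z' e) v = boundary z v + boundary z' v.
Proof. by rewrite /boundary !big_split /=; ring. Qed.

Lemma boundaryN z v : boundary (fun e => - z e) v = - boundary z v.
Proof. by rewrite /boundary !sumrN; ring. Qed.

Definition edge_chain (e : E) : E -> int := fun f => (f == e)%:R.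

Lemma boundary_edge e v : boundary (edge_chain e) v = (v == tgt e)%:R - (v == src e)%:R.
Proof.
have h (f : E -> V) : \sum_(e' | f e' == v) edge_chain e e' = (v == f e)%:R.
  rewrite big_mkcond (bigD1 e) //= big1 ?addr0 => [|e' /negbTE h].
    by rewrite /edge_chain eqxx eq_sym; case: ifP.
  by rewrite /edge_chain h if_same.
by rewrite /boundary !h.
Qed.

Lemma rho_edge e : rho (edge_chain e) = gam e.
Proof.
rewrite /rho (bigD1 e) //= big1 ?addr0 => [|f /negbTE h]; rewrite /edge_chain.
  by rewrite eqxx mul1r.
by rewrite h mul0r.
Qed.

(** Summation by parts turns [rho z] into the sum of [s v] times the boundary of [z] at [v]. *)
Lemma potential_trivial_rho S s : potential S s -> trivial_rho S.
Proof.
move=> hs z [hz hb].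
have oppZ2 (a : 'Z_2) : - a = a by apply/eqP; rewrite eq_sym -addr_eq0 addrr_Z2.
have h e : (z e)%:~R * gam e = (z e)%:~R * s (tgt e) - (z e)%:~R * s (src e).
  case: (boolP (e \in S)) => he; last by rewrite hz // !mul0r subr0.
  by rewrite hs // mulrDr -[in RHS]mulrN oppZ2.
rewrite /Defs.rho; under eq_bigr => e _ do rewrite h.
have part (f : E -> V) : \sum_e (z e)%:~R * s (f e) =
    \sum_v (\sum_(e | f e == v) z e)%:~R * s v.
  rewrite (partition_big f predT) //=; apply: eq_bigr => v _.
  rewrite rmorph_sum mulr_suml /=; apply: eq_bigr => e /eqP -> //.
rewrite sumrB !part -sumrB big1 // => v _.
by rewrite -mulrBl -rmorphB /= hb mul0r.
Qed.

Lemma adj_sym S : symmetric (adj S).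
Proof. by move=> x y; apply: eq_existsb => e; rewrite orbC. Qed.

Lemma connect_adj_sym S : connect_sym (adj S).
Proof. exact/sym_connect_sym/adj_sym. Qed.

Lemma connect_chain S x y : connect (adj S) x y ->
  exists z, chain S z /\ forall v, boundary z v = (v == y)%:R - (v == x)%:R.
Proof.
move=> /connectP [p]; elim: p x => [x _ ->|x' p IH x /= /andP[/exists_inP [e he hxx] hp] hy].
  by exists (fun=> 0); split=> // v; rewrite subrr /boundary !big1 // subrr.
have [z [hz hb]] := IH x' hp hy.
have chain_edge : chain S (edge_chain e).
  by move=> f hf; rewrite /edge_chain; case: eqP hf => // ->; rewrite he.
case/orP: hxx => /andP[/eqP hs /eqP ht].
  exists (fun f => z f + edge_chain e f); split.
    by move=> f hf; rewrite hz // chain_edge // addr0.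
  by move=> v; rewrite boundaryD hb boundary_edge hs ht; ring.
exists (fun f => z f + - edge_chain e f); split.
  by move=> f hf; rewrite hz // chain_edge // oppr0 addr0.
by move=> v; rewrite boundaryD boundaryN hb boundary_edge hs ht; ring.
Qed.

Lemma edge_adj S e : e \in S -> adj S (src e) (tgt e).
Proof. by move=> he; apply/exists_inP; exists e; rewrite // !eqxx. Qed.

(** The potential at [y] is the color of a chain from the root of its component to [y]; an edge
    closes two such chains to a cycle. *)
Lemma trivial_rho_balanced S : trivial_rho S -> balanced S.
Proof.
move=> hS.
have [|Z hZ] := @boolp.choice V (E -> int) (fun y z => chain S z /\
    forall v, boundary z v = (v == y)%:R - (v == fingraph.root (adj S) y)%:R).
  by move=> y; apply: connect_chain; rewrite connect_adj_sym connect_root.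
exists (fun y => rho (Z y)) => e he.
have hroot : fingraph.root (adj S) (src e) = fingraph.root (adj S) (tgt e).
  by apply/fingraph.rootP; [exact: connect_adj_sym|apply/connect1/edge_adj].
have [h1 b1] := hZ (src e); have [h2 b2] := hZ (tgt e).
have : rho (fun f => (Z (src e) f + edge_chain e f) + - Z (tgt e) f) = 0.
  apply: hS; split=> [f hf|v].
    rewrite h1 // h2 // /edge_chain; case: eqP hf => [->|_ _]; last by rewrite subrr.
    by rewrite he.
  rewrite -[LHS]/(boundary _ v) boundaryD boundaryD boundaryN b1 b2 boundary_edge hroot.
  by ring.
rewrite !rhoD rhoN rho_edge => h.
have e0 : rho (Z (src e)) + gam e = rho (Z (tgt e)) by apply/eqP; rewrite -subr_eq0 h.
by rewrite -e0 addKr_Z2.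
Qed.

Lemma connect_VF F x y : x \in VF F -> connect (adj F) x y -> y \in VF F.
Proof.
move=> hx /connectP [p]; elim: p x hx => [x hx _ -> //|x' p IH x hx /= /andP[hxx hp] hy].
apply: IH hp hy; have /exists_inP [e he /orP h] := hxx; apply/VFP; exists e => //.
by case: h => /andP[/eqP h1 /eqP h2]; [right|left].
Qed.

Lemma comps_partition F : partition (comps F) (VF F).
Proof.
have -> : comps F = equivalence_partition (connect (adj F)) (VF F).
  apply: eq_in_imset => x hx; apply/setP => y; rewrite in_set [RHS]in_set.
  by apply/idP/andP => [h|[]//]; split=> //; apply: connect_VF hx h.
apply/equivalence_partitionP => x y t _ _ _; split=> [|hxy].
  exact: connect0.
exact: (same_connect (@connect_adj_sym F) hxy).
Qed.

Lemma mem_comps_closed F C x y : C \in comps F -> x \in C -> connect (adj F) x y -> y \in C.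
Proof.
move=> /imsetP [u hu ->]; rewrite !inE; exact: connect_trans.
Qed.

Lemma VF_compE F C : C \in comps F -> VF (compE F C) = C.
Proof.
move=> hC; apply/setP => v; apply/VFP/idP => [[e]|hv].
  rewrite inE => /andP[he hs] [<- //|<-].
  by apply: (mem_comps_closed hC hs); apply/connect1/edge_adj.
have hvF : v \in VF F.
  by case/imsetP: hC hv => u hu ->; rewrite inE; apply: connect_VF.
case/VFP: hvF => e he hev; exists e => //; rewrite inE he /=.
case: hev => hev; first by rewrite hev.
apply: (mem_comps_closed hC hv); rewrite -hev connect_adj_sym.
exact/connect1/edge_adj.
Qed.

Lemma comps_neq0 F C : C \in comps F -> C != set0.
Proof.
by move=> /imsetP [u hu ->]; apply/set0Pn; exists u; rewrite inE connect0.
Qed.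

Lemma sum_card_compE F : (\sum_(C in comps F) #|compE F C| = #|F|)%N.
Proof.
have [/eqP hcov htriv _] := and3P (comps_partition F).
transitivity (\sum_(C in comps F) \sum_(e in F) (src e \in C : nat))%N.
  apply: eq_bigr => C _; rewrite -sum1dep_card big_mkcondr /=.
  by apply: eq_bigr => e _; case: (_ \in C).
rewrite exchange_big /= -sum1_card; apply: eq_bigr => e he.
have [hs _] := mem_VF src tgt he.
have hsc : src e \in cover (comps F) by rewrite hcov.
rewrite (bigD1 (pblock (comps F) (src e))) ?pblock_mem //= mem_pblock hsc.
rewrite big1 ?addn0 // => C /andP[hC hn]; apply/eqP; rewrite eqb0.
by apply: contraNN hn => h; rewrite (def_pblock htriv hC h).
Qed.

Lemma card_comps F :
  (c_nontriv src tgt gam F + c_triv src tgt gam F = #|comps F|)%N.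
Proof.
rewrite -(cardsID [set C | `[< trivial_rho (compE F C) >]] (comps F)) addnC.
by congr (_ + _)%N; apply: eq_card => C; rewrite !inE -?asbool_neg // andbC.
Qed.

Lemma card_comps_gt0 F : F != set0 -> (0 < #|comps F|)%N.
Proof.
case/set0Pn => e he; apply/card_gt0P; exists [set y | connect (adj F) (src e) y].
by apply: imset_f; case: (mem_VF src tgt he).
Qed.

(** Forward, a nonempty set has a component, and all its components are trivial if it is balanced.
    Backward, the sparsity counts of the components are added. *)
Lemma reflection_lamanP : reflection_laman src tgt gam <->
  (#|E|.+1 = 2 * #|V|)%N /\ sparse src tgt gam [set: E].
Proof.
split=> [[hE hF]|[hE hF]].
  split; first by clear -hE; lia.
  move=> X _ hX; have := hF X; have := card_comps X; have := card_comps_gt0 hX.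
  set a := c_nontriv _ _ _ _; set b := c_triv _ _ _ _ => h1 h2 h3.
  split; first by clear -h1 h2 h3; lia.
  move=> [s ps]; suff hab : b = #|comps X| by clear -h1 h2 h3 hab; lia.
  apply: eq_card => C; rewrite inE; case: (C \in _) => //=.
  apply/asboolP; apply: (@potential_trivial_rho _ s).
  by apply: potential_sub ps; apply/subsetP => e; rewrite inE => /andP[].
split; first by clear -hE; lia.
move=> F; have cV := card_partition (comps_partition F).
pose T C := `[< trivial_rho (compE F C) >].
suff h : (#|F| + (c_nontriv src tgt gam F + 3 * c_triv src tgt gam F) <= 2 * #|VF F|)%N.
  by clear -h; lia.
have -> : (c_nontriv src tgt gam F + 3 * c_triv src tgt gam F =
    \sum_(C in comps F) (if T C then 3 else 1))%N.
  rewrite [RHS](bigID T) /= addnC; congr (_ + _)%N; last first.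
    rewrite (eq_bigr (fun=> 1%N)) => [|C /andP[_ /negbTE ->] //].
    rewrite sum1dep_card; apply: eq_card => C; rewrite !inE asbool_neg //.
  rewrite (eq_bigr (fun=> 3%N)) => [|C /andP[_ ->] //].
  rewrite sum_nat_const mulnC; congr (_ * _)%N; apply: eq_card => C; by rewrite !inE.
rewrite cV -sum_card_compE -big_split big_distrr /=; apply: leq_sum => C hC.
have hCE := VF_compE hC; have hne : compE F C != set0.
  apply: contra_neq (comps_neq0 hC) => h; rewrite -hCE h.
  by apply/setP => v; rewrite [RHS]inE; apply/VFP => -[e]; rewrite inE.
have [h1 h2] := hF _ (subsetT _) hne; rewrite hCE in h1 h2.
rewrite /T; case: asboolP => // hT; apply: h2.
exact: trivial_rho_balanced.
Qed.

End Homology.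

(** * Symmetric configurations of the plane *)

Section Plane.
Variable R : realType.
Implicit Types (x y u : pt R) (c k : R).

Lemma dotE x y : dot x y = x 0 0 * y 0 0 + x 0 1 * y 0 1.
Proof.
rewrite /dot mxE !big_ord_recl big_ord0 !mxE addr0.
by congr (_ + x _ _ * y _ _); apply/val_inj.
Qed.

Definition perp u : pt R := \row_i (if i == 0 then - u 0 1 else u 0 0).

Lemma perp0 u : perp u 0 0 = - u 0 1. Proof. by rewrite mxE. Qed.
Lemma perp1 u : perp u 0 1 = u 0 0. Proof. by rewrite mxE. Qed.

Lemma rowP2 x y : x 0 0 = y 0 0 -> x 0 1 = y 0 1 -> x = y.
Proof.
move=> h0 h1; apply/rowP => -[[|[|//]] hi].
  by have -> : Ordinal hi = 0 by exact: val_inj.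
by have -> : Ordinal hi = 1 by exact: val_inj.
Qed.

Lemma dotDl x y u : dot (x + y) u = dot x u + dot y u.
Proof. by rewrite !dotE !mxE; ring. Qed.

Lemma dotZl k x u : dot (k *: x) u = k * dot x u.
Proof. by rewrite !dotE !mxE; ring. Qed.

Lemma dotBl x y u : dot (x - y) u = dot x u - dot y u.
Proof. by rewrite !dotE !mxE; ring. Qed.

Lemma dot_perp u : dot u (perp u) = 0.
Proof. by rewrite !dotE perp0 perp1; ring. Qed.

Lemma dot_perpl u : dot (perp u) u = 0.
Proof. by rewrite !dotE perp0 perp1; ring. Qed.

Lemma dot_perp_perp u : dot (perp u) (perp u) = dot u u.
Proof. by rewrite !dotE perp0 perp1; ring. Qed.

Lemma unit_sqr u : dot u u = 1 -> u 0 0 * u 0 0 = 1 - u 0 1 * u 0 1.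
Proof. by rewrite dotE => <-; ring. Qed.

Lemma dot_frame u x : dot u u = 1 -> dot x x = dot x (perp u) ^+ 2 + dot x u ^+ 2.
Proof. by rewrite !(dotE x) perp0 perp1 => /unit_sqr h; ring: h. Qed.

Lemma frameE u x : dot u u = 1 -> x = dot x (perp u) *: perp u + dot x u *: u.
Proof.
move=> /unit_sqr h; rewrite !dotE !perp0 !perp1.
by apply: rowP2; rewrite !mxE /=; ring: h.
Qed.

Lemma mul_outer x u y : x *m (u^T *m y) = dot x u *: y.
Proof. by rewrite mulmxA (mx11_scalar (x *m u^T)) mul_scalar_mx. Qed.

Lemma aff_reflection u c x :
  aff (1%:M - 2 *: (u^T *m u)) ((2 * c) *: u) x = x - (2 * (dot x u - c)) *: u.
Proof.
rewrite /aff mulmxBr mulmx1 -scalemxAr mul_outer scalerA.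
by apply/rowP => i; rewrite !mxE; ring.
Qed.

(* The isometry that maps the frame (perp u, u) to (perp v, v). *)
Definition frame_mx u v : 'M[R]_2 := (perp u)^T *m perp v + u^T *m v.

Lemma frame_mxE u v x : x *m frame_mx u v = dot x (perp u) *: perp v + dot x u *: v.
Proof. by rewrite mulmxDr !mul_outer. Qed.

Lemma eq_mx2 (A B : 'M[R]_2) : (forall x : pt R, x *m A = x *m B) -> A = B.
Proof. by move=> h; apply/row_matrixP => i; rewrite !rowE h. Qed.

Lemma frame_mx_euc u v : dot u u = 1 -> dot v v = 1 -> is_euc (frame_mx u v).
Proof.
move=> hu hv; apply: eq_mx2 => x; rewrite mulmxA frame_mxE mulmx1.
have -> : (frame_mx u v)^T = frame_mx v u.
  by rewrite /frame_mx linearD /= !trmx_mul !trmxK.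
rewrite frame_mxE !dotDl !dotZl dot_perp_perp dot_perp dot_perpl hv.
by rewrite !mulr0 !mulr1 addr0 add0r -frameE.
Qed.

Lemma euc_dot (Q : 'M[R]_2) x : is_euc Q -> dot (x *m Q) (x *m Q) = dot x x.
Proof.
by move=> hQ; rewrite /dot trmx_mul mulmxA -(mulmxA x) hQ mulmx1.
Qed.

Lemma dot_ge0 x : 0 <= dot x x.
Proof. by rewrite dotE -!expr2 addr_ge0 ?sqr_ge0. Qed.

Lemma norm_eq x y : norm x = norm y <-> dot x x = dot y y.
Proof.
split=> [h|h]; last by rewrite /norm h.
by rewrite -(sqr_sqrtr (dot_ge0 x)) -(sqr_sqrtr (dot_ge0 y)) -/(norm x) h.
Qed.

Lemma coord_le_norm x i : `|x 0 i| <= norm x.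
Proof.
rewrite -sqrtr_sqr ler_wsqrtr // dotE -!expr2.
case: i => -[|[|//]] hi.
  by have -> : Ordinal hi = 0 by [exact: val_inj]; rewrite lerDl sqr_ge0.
by have -> : Ordinal hi = 1 by [exact: val_inj]; rewrite lerDr sqr_ge0.
Qed.

Lemma norm_lt x (d : R) : 0 < d -> dot x x < d ^+ 2 -> norm x < d.
Proof. by move=> d0 h; rewrite -(ger0_norm (ltW d0)) -sqrtr_sqr ltr_sqrt // exprn_gt0. Qed.

End Plane.

Lemma Z2_cases (g : 'Z_2) : g = 0 \/ g = 1.
Proof. by case: g => -[|[|//]] hi; [left|right]; exact: val_inj. Qed.

Section Coordinates.
Variables (R : realType) (V E : finType) (src tgt : E -> V) (gam : E -> 'Z_2).
Implicit Types (p q : liftV V -> pt R) (u : pt R) (c : R) (z : V * bool -> R).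
Notation rig_row := (rig_row src tgt gam).
Notation len := (len src tgt gam).

Definition reflA u : 'M[R]_2 := 1%:M - 2 *: (u^T *m u).
Definition reflb u c : pt R := (2 * c) *: u.

(* Coordinates of a symmetric configuration with respect to the mirror dot x u = c, and back. *)
Definition zof u c p (k : V * bool) : R :=
  if k.2 then dot (p (k.1, 0)) u - c else dot (p (k.1, 0)) (perp u).

Definition pof u c z (v : liftV V) : pt R :=
  z (v.1, false) *: perp u + (c + sg R v.2 * z (v.1, true)) *: u.

Lemma sg0 : sg R 0 = 1. Proof. by rewrite /sg expr0. Qed.
Lemma sg1 : sg R 1 = -1. Proof. by rewrite /sg expr1. Qed.

Lemma pofK u c p : dot u u = 1 -> is_symmetric p (reflA u) (reflb u c) ->
  p = pof u c (zof u c p).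
Proof.
move=> hu hp; apply: funext => -[v g].
have h0 : p (v, 0) = pof u c (zof u c p) (v, 0).
  rewrite /pof /zof /= sg0 mul1r addrC [c + _]addrC subrK addrC; exact: frameE.
case: (Z2_cases g) => -> //.
have -> : (v, 1) = phi (v, 0) :> liftV V by rewrite /phi /= add0r.
rewrite hp aff_reflection {1}h0 /pof /zof /phi /= sg0 add0r sg1.
by apply/rowP => i; rewrite !mxE; ring.
Qed.

Lemma pof_symmetric u c z : dot u u = 1 ->
  is_symmetric (pof u c z) (reflA u) (reflb u c).
Proof.
move=> hu [v g]; rewrite aff_reflection /pof /phi /= sgD sg1 !dotDl !dotZl dot_perpl hu.
by apply/rowP => i; rewrite !mxE; ring.
Qed.

(** Both lifts of an edge have the same length because the sign [sg R g] enters only squared. *)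
Lemma edge_length u c z e g : dot u u = 1 ->
  let q := pof u c z in
  dot (q (tgt e, g + gam e) - q (src e, g)) (q (tgt e, g + gam e) - q (src e, g)) = len z e.
Proof.
move=> hu q; rewrite (dot_frame _ hu) !dotBl /q /pof /= !dotDl !dotZl.
rewrite dot_perp_perp dot_perpl dot_perp hu sgD lenE.
have hg := sg_sqr R g; have he := sg_sqr R (gam e).
move: (sg R g) (sg R (gam e)) hg he => a d ha hd.
by rewrite !mulr0 !mulr1 !addr0 !add0r; ring: ha hd.
Qed.

End Coordinates.

Section PlaneBounds.
Variable R : realType.
Implicit Types (x y u : pt R).

Lemma dot_le x y (a b : R) : (forall i, `|x 0 i| <= a) -> (forall i, `|y 0 i| <= b) ->
  `|dot x y| <= 2 * (a * b).
Proof.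
move=> hx hy; rewrite dotE; apply: le_trans (ler_normD _ _) _.
have h i : `|x 0 i * y 0 i| <= a * b by rewrite normrM ler_pM.
by have := h 0; have := h 1; lra.
Qed.

Lemma unit_coord_le1 u i : dot u u = 1 -> `|u 0 i| <= 1.
Proof. by move=> hu; have := coord_le_norm u i; rewrite /norm hu sqrtr1. Qed.

Lemma perp_coord_le u (a : R) : (forall i, `|u 0 i| <= a) -> forall i, `|perp u 0 i| <= a.
Proof. by move=> h i; rewrite mxE; case: ifP => _; rewrite ?normrN. Qed.

Lemma reflAE u i j : reflA u i j = (i == j)%:R - 2 * (u 0 i * u 0 j).
Proof. by rewrite !mxE big_ord_recl big_ord0 addr0 !mxE. Qed.

Lemma reflAN u : reflA (- u) = reflA u.
Proof. by apply/matrixP => i j; rewrite !reflAE !mxE; ring. Qed.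

Lemma reflbN u c : reflb (- u) (- c) = reflb u c.
Proof. by rewrite /reflb mulrN scaleNr scalerN opprK. Qed.

(** A reflection determines its normal up to sign, and [0 <= dot u v] fixes the sign. Entries within
    [s ^+ 2] give [1 - 2 * s ^+ 2 <= dot u v ^+ 2], hence distance at most [2 * s]: matrices control
    normals only through a square root. *)
Lemma normal_close u v (s : R) : dot u u = 1 -> dot v v = 1 -> 0 <= dot u v -> 0 < s ->
  (forall i j, `|reflA v i j - reflA u i j| < s ^+ 2) -> forall i, `|v 0 i - u 0 i| <= 2 * s.
Proof.
move=> hu hv huv s0 h.
have hP i j : `|u 0 i * u 0 j * (v 0 i * v 0 j - u 0 i * u 0 j)| <= s ^+ 2 / 2.
  rewrite normrM.
  have h1 : `|u 0 i * u 0 j| <= 1.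
    by rewrite normrM mulr_ile1 // unit_coord_le1.
  have h2 : `|v 0 i * v 0 j - u 0 i * u 0 j| <= s ^+ 2 / 2.
    have := h i j; rewrite !reflAE.
    have -> : (i == j)%:R - 2 * (v 0 i * v 0 j) - ((i == j)%:R - 2 * (u 0 i * u 0 j)) =
      - 2 * (v 0 i * v 0 j - u 0 i * u 0 j) by ring.
    by rewrite normrM normrN normr_nat; lra.
  by apply: le_trans (ler_pM _ _ h1 h2) _; rewrite ?mul1r.
have hd2 : 1 - 2 * s ^+ 2 <= dot u v ^+ 2.
  have -> : dot u v ^+ 2 = dot u u ^+ 2 +
    (u 0 0 * u 0 0 * (v 0 0 * v 0 0 - u 0 0 * u 0 0) +
     u 0 0 * u 0 1 * (v 0 0 * v 0 1 - u 0 0 * u 0 1) +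
     u 0 1 * u 0 0 * (v 0 1 * v 0 0 - u 0 1 * u 0 0) +
     u 0 1 * u 0 1 * (v 0 1 * v 0 1 - u 0 1 * u 0 1)) by rewrite !dotE; ring.
  have := hP 0 0; have := hP 0 1; have := hP 1 0; have := hP 1 1.
  rewrite !ler_norml => /andP[? _] /andP[? _] /andP[? _] /andP[? _].
  by rewrite hu expr1n; lra.
have d1 : dot (v - u) (v - u) = 2 - 2 * dot u v.
  have -> : dot (v - u) (v - u) = dot u u + dot v v - 2 * dot u v.
    by rewrite !dotE !mxE; ring.
  by rewrite hu hv; ring.
have d2 : dot (v - u) (v - u) <= (2 * s) ^+ 2.
  have := dot_ge0 (v - u); rewrite d1 => h1.
  have : dot u v ^+ 2 <= dot u v by rewrite expr2 ler_piMr //; lra.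
  by rewrite exprMn; lra.
move=> i; have -> : v 0 i - u 0 i = (v - u) 0 i by rewrite !mxE.
apply: le_trans (coord_le_norm _ i) _.
by rewrite -(@ger0_norm _ (2 * s)) -?sqrtr_sqr ?ler_wsqrtr //; lra.
Qed.

End PlaneBounds.

(** * From independent rows to rigidity in the plane *)

Section RigidityTransfer.
Variables (R : realType) (V E : finType) (src tgt : E -> V) (gam : E -> 'Z_2).
Implicit Types (p q : liftV V -> pt R) (u : pt R) (c : R) (z : V * bool -> R).
Implicit Types F : {set E}.
Notation rig_row := (rig_row src tgt gam).
Notation len := (len src tgt gam).
Notation rigid := (rigid src tgt gam).

(** The difference of the two lifts does not contain the offset of the mirror, so heights are
    compared through points and normals alone. *)
Lemma zof_height u c p v : dot u u = 1 -> is_symmetric p (reflA u) (reflb u c) ->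
  zof u c p (v, true) = 2^-1 * dot (p (v, 0) - p (v, 1)) u.
Proof.
move=> hu hp; rewrite {2 3}(pofK hu hp) /pof /= sg0 sg1 !(dotBl, dotDl, dotZl) dot_perpl hu.
by rewrite /zof /=; field.
Qed.

Lemma zof_close u v c d p q (s B : R) : dot u u = 1 -> dot v v = 1 ->
  is_symmetric p (reflA u) (reflb u c) -> is_symmetric q (reflA v) (reflb v d) ->
  0 < s -> s <= 1 -> (forall w i, `|p w 0 i| <= B) ->
  (forall i, `|v 0 i - u 0 i| <= 2 * s) -> (forall w, norm (q w - p w) < s ^+ 2) ->
  forall k, `|zof v d q k - zof u c p k| <= 4 * s * (B + 1).
Proof.
move=> hu hv hp hq s0 s1 hB huv hpq [w b].
have ss : s ^+ 2 <= s by rewrite expr2 ler_piMr // ltW.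
have huv' i : `|(v - u) 0 i| <= 2 * s by rewrite !mxE; apply: huv.
have hpq' w' i : `|(q w' - p w') 0 i| <= s ^+ 2.
  by apply: le_trans (coord_le_norm _ i) _; apply/ltW/hpq.
have v1 i : `|v 0 i| <= 1 by exact: unit_coord_le1.
case: b.
  rewrite (zof_height _ hu hp) (zof_height _ hv hq).
  have -> : 2^-1 * dot (q (w, 0) - q (w, 1)) v - 2^-1 * dot (p (w, 0) - p (w, 1)) u =
      2^-1 * (dot (q (w, 0) - p (w, 0)) v - dot (q (w, 1) - p (w, 1)) v +
      (dot (p (w, 0)) (v - u) - dot (p (w, 1)) (v - u))).
    by rewrite !dotE !mxE; ring.
  rewrite normrM ger0_norm; last by rewrite invr_ge0 ler0n.
  have := dot_le (hpq' (w, 0)) v1; have := dot_le (hpq' (w, 1)) v1.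
  have := dot_le (hB (w, 0)) huv'; have := dot_le (hB (w, 1)) huv'.
  move: (dot _ _) (dot _ _) (dot _ _) (dot _ _) => a1 a2 a3 a4.
  rewrite !ler_norml => /andP[? ?] /andP[? ?] /andP[? ?] /andP[? ?].
  suff : `|a1 - a2 + (a3 - a4)| <= 8 * s * (B + 1) by move=> h; lra.
  by rewrite ler_norml; apply/andP; split; lra.
rewrite -[zof v d q (w, false)]/(dot (q (w, 0)) (perp v)).
rewrite -[zof u c p (w, false)]/(dot (p (w, 0)) (perp u)).
have -> : dot (q (w, 0)) (perp v) - dot (p (w, 0)) (perp u) =
    dot (q (w, 0) - p (w, 0)) (perp v) + dot (p (w, 0)) (perp (v - u)).
  by rewrite !dotE !perp0 !perp1 !mxE; ring.
have := dot_le (hpq' (w, 0)) (perp_coord_le v1).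
have := dot_le (hB (w, 0)) (perp_coord_le huv').
move: (dot _ _) (dot _ _) => a1 a2; rewrite !ler_norml => /andP[? ?] /andP[? ?].
by apply/andP; split; lra.
Qed.

Lemma realization_len u v c d p q F : dot u u = 1 -> dot v v = 1 ->
  is_symmetric p (reflA u) (reflb u c) -> is_symmetric q (reflA v) (reflb v d) ->
  realization src tgt gam F p q (reflA v) (reflb v d) ->
  forall e, e \in F -> len (zof v d q) e = len (zof u c p) e.
Proof.
move=> hu hv hp hq [_ [_ h]] e he; have /norm_eq := h e he 0.
rewrite {1 2 3 4}(pofK hv hq) {1 2 3 4}(pofK hu hp).
by rewrite !edge_length.
Qed.

Lemma congruent_of_translation u v c d p q k : dot u u = 1 -> dot v v = 1 ->
  is_symmetric p (reflA u) (reflb u c) -> is_symmetric q (reflA v) (reflb v d) ->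
  (forall x, zof v d q x = zof u c p x + k * translation R x) ->
  congruent p (reflA u) (reflb u c) q (reflA v) (reflb v d).
Proof.
move=> hu hv hp hq hz.
(* Together with [frame_mx u v] this carries the mirror of [p] to that of [q] and shifts by [k]
   along it. *)
pose t := k *: perp v + (d - c) *: v.
have affE x : aff (frame_mx u v) t x =
    (dot x (perp u) + k) *: perp v + (dot x u - c + d) *: v.
  by rewrite /aff frame_mxE /t; apply/rowP => i; rewrite !mxE; ring.
exists (frame_mx u v), t; split; first exact: frame_mx_euc.
split=> [[w g]|x].
  have -> : p (w, g) = pof u c (zof u c p) (w, g) by rewrite -pofK.
  have -> : q (w, g) = pof v d (zof v d q) (w, g) by rewrite -pofK.
  rewrite affE /pof /= !hz /translation /=.
  rewrite !dotDl !dotZl dot_perp_perp dot_perpl dot_perp hu.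
  by apply/rowP => i; rewrite !mxE; ring.
rewrite !aff_reflection !affE.
rewrite !dotBl !dotDl !dotZl hu hv dot_perpl dot_perp.
by apply/rowP => i; rewrite !mxE; ring.
Qed.

(** [F1] may be a proper subset: an edge outside it can be removed without loss of rigidity, which
    is how minimality forces [F0 = setT]. *)
Lemma rigid_of_indep (v0 : V) u c p (F1 F : {set E}) : dot u u = 1 ->
  is_symmetric p (reflA u) (reflb u c) -> F1 \subset F ->
  indep (rig_row (zof u c p)) F1 -> #|F1|.+1 = (2 * #|V|)%N ->
  rigid F p (reflA u) (reflb u c).
Proof.
move=> hu hp sF hF1 hc.
have [eps eps0 h] := reduced_rigid v0 hF1 hc.
pose B := \sum_(w : liftV V) \sum_i `|p w 0 i|.
have B0 : 0 <= B by rewrite sumr_ge0 // => w _; rewrite sumr_ge0.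
have hB w i : `|p w 0 i| <= B.
  rewrite /B (bigD1 w) //= (bigD1 i) //= -addrA lerDl addr_ge0 ?sumr_ge0 // => w' _.
  by rewrite sumr_ge0.
pose s := Num.min 1 (eps / (8 * (B + 1))).
have s0 : 0 < s by rewrite lt_min ltr01 divr_gt0 //; lra.
have s1 : s <= 1 by rewrite ge_min lexx.
have sB : 4 * s * (B + 1) < eps.
  have : s <= eps / (8 * (B + 1)) by rewrite ge_min lexx orbT.
  by rewrite ler_pdivlMr; lra.
exists (s ^+ 2); split; first by rewrite exprn_gt0.
move=> q A' b' hq hqp hA hb.
have [[u1 [c1 [hu1 [eA eb]]]] [hsym _]] := hq.
(* Of the two unit normals of the new mirror, take the one on the side of [u]. *)
have [v [d [hv [{}eA [{}eb huv]]]]] : exists v d, dot v v = 1 /\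
    (A' = reflA v /\ b' = reflb v d /\ 0 <= dot u v).
  have [h0|h0] := lerP 0 (dot u u1); first by exists u1, c1.
  exists (- u1), (- c1); rewrite reflAN reflbN; split.
    by rewrite -hu1 !dotE !mxE; ring.
  do 2!split=> //; have -> : dot u (- u1) = - dot u u1 by rewrite !dotE !mxE; ring.
  lra.
subst A' b'.
have hcl := normal_close hu hv huv s0 hA.
have hzz := zof_close hu hv hp hsym s0 s1 hB hcl hqp.
have [k|e he|k hk] := h (zof v d q).
- exact: le_lt_trans (hzz k) sB.
- by apply: (realization_len hu hv hp hsym hq); exact: (subsetP sF).
exact: (congruent_of_translation hu hv hp hsym hk).
Qed.

End RigidityTransfer.

Lemma exists_gap (R : realFieldType) (T : finType) (f : T -> R) :
  exists2 d : R, 0 < d & forall i, f i != 0 -> d <= `|f i|.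
Proof.
exists (\big[Num.min/1]_(i | f i != 0) `|f i|).
  by elim/big_ind: _ => // [x y hx hy|i hi]; rewrite ?lt_min ?hx ?normr_gt0.
by move=> i hi; rewrite (bigD1 i) //= ge_min lexx.
Qed.

Lemma sqr_close (R : realFieldType) (x y : R) :
  x ^+ 2 = y ^+ 2 -> (y != 0 -> `|x - y| < `|y|) -> x = y.
Proof.
move=> /eqP; rewrite eqf_sqr => /orP[/eqP //|/eqP ->] h.
have [->|/h] := eqVneq y 0; first by rewrite oppr0.
have -> : - y - y = - (2 * y) by ring.
by rewrite normrN normrM normr_nat; have := normr_ge0 y; lra.
Qed.

(** * From deficient rank to flexibility in the plane *)

Section Flexibility.
Variables (R : realType) (V E : finType) (src tgt : E -> V) (gam : E -> 'Z_2).
Implicit Types (p q : liftV V -> pt R) (u : pt R) (c : R) (z : V * bool -> R).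
Notation rig_row := (rig_row src tgt gam).
Notation len := (len src tgt gam).
Notation rigid := (rigid src tgt gam).

Lemma pof_dist u c z v w g h : dot u u = 1 ->
  dot (pof u c z (v, g) - pof u c z (w, h)) (pof u c z (v, g) - pof u c z (w, h)) =
  (z (v, false) - z (w, false)) ^+ 2 +
  (sg R g * z (v, true) - sg R h * z (w, true)) ^+ 2.
Proof.
move=> hu; rewrite (dot_frame _ hu) !dotBl /pof /= !dotDl !dotZl.
by rewrite dot_perp_perp dot_perpl dot_perp hu; ring.
Qed.

(* Congruent configurations have the same pairwise distances, which determine the
   coordinates locally up to translation along the mirror. *)
Lemma exists_congruence_radius (v0 : V) u c z A b A' b' : dot u u = 1 ->
  exists2 d : R, 0 < d & forall z', (forall k, `|z' k - z k| < d) ->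
    congruent (pof u c z) A b (pof u c z') A' b' ->
    exists k, forall x, z' x = z x + k * translation R x.
Proof.
move=> hu.
have [d1 d10 hd1] := exists_gap (fun v => z (v, true)).
have [d2 d20 hd2] := exists_gap (fun vw : V * V => z (vw.1, false) - z (vw.2, false)).
(* Within this radius no nonzero height or difference along the mirror changes sign; two coordinates
   enter a difference, whence the half. *)
exists (Num.min d1 (d2 / 2)); first by rewrite lt_min d10 divr_gt0.
move=> z' hz [Q [t [hQ [hq _]]]].
have hzy k : `|z' k - z k| < d1 by apply: lt_le_trans (hz k) _; rewrite ge_min lexx.
have hzx k : `|z' k - z k| < d2 / 2.
  by apply: lt_le_trans (hz k) _; rewrite ge_min lexx orbT.
have dist v g w h : (z' (v, false) - z' (w, false)) ^+ 2 +
    (sg R g * z' (v, true) - sg R h * z' (w, true)) ^+ 2 =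
    (z (v, false) - z (w, false)) ^+ 2 + (sg R g * z (v, true) - sg R h * z (w, true)) ^+ 2.
  rewrite -!(pof_dist c _ _ _ _ _ hu) -(euc_dot (pof u c z (v, g) - _) hQ) !hq /aff mulmxBl.
  by rewrite opprD addrACA subrr addr0.
(* The distance between the two lifts of [v] is twice its absolute height. *)
have hy v : z' (v, true) = z (v, true).
  apply: sqr_close => [|h]; last exact: lt_le_trans (hzy _) (hd1 v h).
  have := dist v 0 v 1; rewrite !subrr !expr0n /= !add0r !sg0 sg1 !mul1r !mulN1r !opprK.
  by move=> h; apply: (@mulfI _ 4); rewrite ?pnatr_eq0 //; move: h; rewrite !expr2; lra.
have hx v : z' (v, false) - z' (v0, false) = z (v, false) - z (v0, false).
  apply: sqr_close => [|h].
    by have := dist v 0 v0 0; rewrite !hy => /addIr.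
  apply: lt_le_trans (hd2 (v, v0) h).
  have -> : z' (v, false) - z' (v0, false) - (z (v, false) - z (v0, false)) =
    (z' (v, false) - z (v, false)) - (z' (v0, false) - z (v0, false)) by ring.
  apply: le_lt_trans (ler_normB _ _) _.
  by have := hzx (v, false); have := hzx (v0, false); lra.
exists (z' (v0, false) - z (v0, false)) => -[v []]; rewrite /translation /=.
  by rewrite hy; ring.
by have := hx v; lra.
Qed.

(** The reduced flex is realized with the mirror of [p] kept fixed, and so close to [p] that a
    congruence could only be a translation along it. *)
Lemma not_rigid_of_maximal (v0 : V) u c p (F F0 : {set E}) : dot u u = 1 ->
  is_symmetric p (reflA u) (reflb u c) -> F0 \subset F ->
  indep (rig_row (zof u c p)) F0 -> (#|F0|.+1 < 2 * #|V|)%N ->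
  (forall z e, e \in F -> e \notin F0 -> ~ indep (rig_row z) (e |: F0)) ->
  ~ rigid F p (reflA u) (reflb u c).
Proof.
move=> hu hp sF hF0 hc hmax [eps [eps0 hrig]].
set z := zof u c p in hF0.
have pE : p = pof u c z by exact: pofK.
have [d d0 hd] := exists_congruence_radius v0 c z (reflA u) (reflb u c)
  (reflA u) (reflb u c) hu.
(* [d] excludes congruence; two coordinates moving by less than [eps / 2] keep each point within
   [eps]. *)
have [|z' [hz hlen hno]] := reduced_flexible v0 sF hF0 hc hmax (eps := Num.min d (eps / 2)).
  by rewrite lt_min d0 divr_gt0.
apply: hno; apply: hd => [k|].
  by apply: lt_le_trans (hz k) _; rewrite ge_min lexx.
rewrite -pE; apply: hrig.
- split; first by exists u, c.
  split=> [|e he g]; first exact: pof_symmetric.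
  by apply/norm_eq; rewrite pE !edge_length // hlen.
- have hze k : `|z' k - z k| < eps / 2.
    by apply: lt_le_trans (hz k) _; rewrite ge_min lexx orbT.
  move=> [v g]; apply: norm_lt => //; rewrite (dot_frame _ hu) pE !dotBl /pof /=.
  rewrite !dotDl !dotZl dot_perp_perp dot_perpl dot_perp hu.
  have h2 k : (z' k - z k) ^+ 2 < (eps / 2) ^+ 2.
    have := hze k; rewrite ltr_norml => /andP[h3 h4].
    rewrite -subr_gt0 subr_sqr mulr_gt0 //; lra.
  have := h2 (v, false); have := h2 (v, true); have := sg_sqr R g.
  move: (sg R g) => a ha h3 h4.
  have -> : (z' (v, false) * 1 + (c + a * z' (v, true)) * 0 -
    (z (v, false) * 1 + (c + a * z (v, true)) * 0)) ^+ 2 +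
    (z' (v, false) * 0 + (c + a * z' (v, true)) * 1 -
    (z (v, false) * 0 + (c + a * z (v, true)) * 1)) ^+ 2 =
    (z' (v, false) - z (v, false)) ^+ 2 + (z' (v, true) - z (v, true)) ^+ 2.
    by rewrite !mulr0 !mulr1 !addr0 !add0r; ring: ha.
  by have := sqr_ge0 eps; rewrite expr_div_n in h3 h4; lra.
- by move=> i j; rewrite subrr normr0.
- by rewrite subrr; apply: norm_lt; rewrite // dotE !mxE !mul0r addr0 exprn_gt0.
Qed.

End Flexibility.

(** * The genericity polynomial *)

Section GenericityPolynomial.
Import mpoly.
Variables (R : realType) (V E : finType) (src tgt : E -> V) (gam : E -> 'Z_2).
Implicit Types (p q : liftV V -> pt R) (u : pt R) (c : R) (z : V * bool -> R).
Notation rig_row := (rig_row src tgt gam).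

(* Sum and difference of the first coordinates of the two lifts of a vertex: up to scaling
   and a common translation these are the reduced coordinates, for every mirror. *)
Definition sumdiff p (k : V * bool) : R :=
  p (k.1, 0) 0 0 + (-1) ^+ k.2 * p (k.1, 1) 0 0.

Lemma row_sumdiff u c z e k : rig_row (sumdiff (pof u c z)) e k =
  2 * (if k.2 then u 0 0 else - u 0 1) * rig_row z e k.
Proof.
case: k => v b; rewrite !row_sym /sumdiff /pof /=.
rewrite !mxE /= !sg0 sg1; case: b => /=; rewrite ?expr0 ?expr1; first by ring.
by rewrite !mul1r; ring.
Qed.

(** The rows differ by a column factor that may vanish when the mirror is parallel to a coordinate
    axis, so the converse can fail; this is the implication that [P != 0] calls for. *)
Lemma indep_sumdiff u c z (F : {set E}) :
  indep (rig_row (sumdiff (pof u c z))) F -> indep (rig_row z) F.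
Proof.
move=> h w hw; apply: h => k.
under eq_bigr => e _ do rewrite row_sumdiff mulrCA.
by rewrite -mulr_sumr hw mulr0.
Qed.

Lemma sumdiff_surj z : exists p, symmetric_config p /\ sumdiff p = z.
Proof.
(* A rational unit normal with both coordinates nonzero, so that no column factor vanishes. *)
pose u : pt R := \row_i (if i == 0 then 3 / 5 else 4 / 5).
have u0 : u 0 0 = 3 / 5 by rewrite mxE.
have u1 : u 0 1 = 4 / 5 by rewrite mxE.
have hu : dot u u = 1 by rewrite dotE u0 u1; field.
pose z' (k : V * bool) := z k / (2 * (if k.2 then 3 / 5 else - (4 / 5))).
exists (pof u 0 z'); split.
  exists (reflA u), (reflb u 0); split; last exact: pof_symmetric.
  by exists u, 0.
apply: funext => -[v b]; rewrite /sumdiff /pof /= !mxE /= !sg0 sg1 /z' /=.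
by case: b; rewrite /= ?expr0 ?expr1; field.
Qed.

Definition xpoly (w : liftV V) : mpoly.mpoly (NC V) R :=
  mpoly.mpolyX R (mpoly.mnm1 (enum_rank (w, 0 : 'I_2))).

Definition zpoly (k : V * bool) : mpoly.mpoly (NC V) R :=
  xpoly (k.1, 0) + (-1) ^+ k.2 * xpoly (k.1, 1).

Definition rowpoly e (k : V * bool) : mpoly.mpoly (NC V) R :=
  \sum_b (zpoly (tgt e, b) - mpoly.mpolyC (NC V) (sgb R (gam e) b) * zpoly (src e, b)) *
    mpoly.mpolyC (NC V) (dcoef R src tgt gam e b k).

Lemma meval_xpoly p w : mpoly.meval (coords p) (xpoly w) = p w 0 0.
Proof. by rewrite /xpoly mpoly.mevalXU /coords enum_rankK. Qed.

Lemma meval_zpoly p k : mpoly.meval (coords p) (zpoly k) = sumdiff p k.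
Proof.
by rewrite /zpoly rmorphD rmorphM /= rmorphXn /= rmorphN1 !meval_xpoly.
Qed.

Lemma meval_rowpoly p e k : mpoly.meval (coords p) (rowpoly e k) = rig_row (sumdiff p) e k.
Proof.
rewrite /rowpoly rmorph_sum /=; apply: eq_bigr => b _.
by rewrite rmorphM rmorphB rmorphM /= !mpoly.mevalC !meval_zpoly.
Qed.

(* The polynomial is det (N W), where N is the generic matrix of the rows in F and W is a
   right inverse of its value at z. *)
Lemma exists_genericity_polynomial z (F : {set E}) : indep (rig_row z) F ->
  exists P : mpoly.mpoly (NC V) R,
    (forall p, sumdiff p = z -> mpoly.meval (coords p) P != 0) /\
    (forall p, mpoly.meval (coords p) P != 0 -> indep (rig_row (sumdiff p)) F).
Proof.
move=> /indep_rinv [W hW].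
pose N p : 'M[R]_#|F| :=
  \matrix_(i, j) \sum_k rig_row (sumdiff p) (enum_val i) k * W k (enum_val j).
pose PM : 'M[mpoly.mpoly (NC V) R]_#|F| :=
  \matrix_(i, j) \sum_k rowpoly (enum_val i) k * mpoly.mpolyC (NC V) (W k (enum_val j)).
have NE p : mpoly.meval (coords p) (\det PM) = \det (N p).
  rewrite -det_map_mx; congr (\det _); apply/matrixP => i j; rewrite !mxE rmorph_sum /=.
  by apply: eq_bigr => k _; rewrite rmorphM /= mpoly.mevalC meval_rowpoly.
exists (\det PM); split=> p; rewrite NE => hp.
  have -> : N p = 1%:M.
    apply/matrixP => i j; rewrite !mxE hp hW ?enum_valP //.
    by rewrite (inj_eq enum_val_inj).
  by rewrite det1 oner_neq0.
move=> w hw.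
have hrow : (\row_i w (enum_val i)) *m N p = 0.
  apply/rowP => j; rewrite !mxE.
  under eq_bigr => i _ do rewrite !mxE mulr_sumr.
  rewrite exchange_big big1 //= => k _.
  under eq_bigr => i _ do rewrite mulrA.
  by rewrite -mulr_suml -(big_enum_val (fun e => w e * rig_row (sumdiff p) e k)) hw mul0r.
have hu : N p \in unitmx by rewrite unitmxE unitfE.
have h0 : \row_i w (enum_val i) = 0 :> 'rV_#|F|.
  by rewrite -[LHS](mulmxK hu) hrow mul0mx.
move=> e he; have /rowP/(_ (enum_rank_in he e)) := h0.
by rewrite !mxE enum_rankK_in.
Qed.

End GenericityPolynomial.

(** The maximum runs over all configurations, so that no configuration at all makes [F] plus an edge
    independent. *)
Lemma exists_maximal_indep (R : realType) (V E : finType) (src tgt : E -> V) (gam : E -> 'Z_2) :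
  exists (z : V * bool -> R) (F : {set E}), indep (@rig_row R V E src tgt gam z) F /\
    forall z' F', indep (@rig_row R V E src tgt gam z') F' -> (#|F'| <= #|F|)%N.
Proof.
pose Q n := `[< exists z : V * bool -> R, exists2 F : {set E},
  indep (@rig_row R V E src tgt gam z) F & #|F| = n >].
have exQ : exists n, Q n.
  exists 0; apply/asboolP; exists (fun=> 0), set0; last by rewrite cards0.
  by move=> w _ e; rewrite inE.
have Qle n : Q n -> (n <= #|E|)%N.
  by move=> /asboolP [z [F _ <-]]; exact: max_card.
case: (ex_maxnP exQ Qle) => n /asboolP [z [F hF hn]] hmax.
exists z, F; split=> // z' F' hF'; rewrite hn; apply: hmax.
by apply/asboolP; exists z', F'.
Qed.

Theorem theorem1 (R : realType) (V E : finType) (src tgt : E -> V)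
    (gam : E -> 'Z_2) (HV : (0 < #|V|)%N) :
  exists P : mpoly.mpoly (NC V) R,
    (* the exceptional algebraic set {P = 0} is a proper subset of the
       space of symmetric point configurations *)
    (exists p, symmetric_config p /\ mpoly.meval (coords p) P != 0) /\
    (* every generic symmetric realization is minimally rigid iff
       the colored graph is reflection-Laman *)
    forall (p : liftV V -> pt R) (A : 'M[R]_2) (b : pt R),
      is_reflection A b -> is_symmetric p A b ->
      mpoly.meval (coords p) P != 0 ->
      (minimally_rigid src tgt gam p A b <-> reflection_laman src tgt gam).
Proof.
have [v0 _] := card_gt0P HV.
have [z0 [F0 [hz0 hmax]]] := exists_maximal_indep R src tgt gam.
have [P [P1 P2]] := exists_genericity_polynomial hz0.
exists P; split.
  by have [p [hp hz]] := sumdiff_surj z0; exists p; split=> //; exact: P1.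
move=> p A b [u [c [hu [-> ->]]]] hp hP.
rewrite -/(reflA u) -/(reflb u c) in hp *.
have hF0 : indep (rig_row src tgt gam (zof u c p)) F0.
  by apply: (indep_sumdiff (u := u) (c := c)); rewrite -pofK //; exact: P2.
have cF0 : (#|F0|.+1 <= 2 * #|V|)%N.
  have [->|hn] := eqVneq F0 set0; first by rewrite cards0; lia.
  have [h _] := indep_sparse hF0 (subxx _) hn.
  by have := max_card (VF src tgt F0); lia.
rewrite reflection_lamanP; split=> [[hrig hmin]|[hE hs]].
  have hc : #|F0|.+1 = (2 * #|V|)%N.
    apply/eqP; rewrite eqn_leq cF0 leqNgt; apply/negP => hlt.
    apply: (not_rigid_of_maximal v0 hu hp (subsetT F0) hF0 hlt _ hrig) => z e _ he hind.
    by have := hmax _ _ hind; rewrite cardsU1 he; lia.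
  have F0T : F0 = setT.
    apply/eqP; rewrite eqEsubset subsetT /=; apply/subsetP => e _.
    (* An edge outside [F0] could be removed without losing rigidity. *)
    apply/negPn/negP => he; apply: (hmin e).
    apply: (rigid_of_indep v0 hu hp _ hF0 hc); apply/subsetP => f hf.
    by rewrite in_setD1 in_setT andbT; apply: contraNneq he => <-.
  rewrite F0T in hF0 hc; split; last exact: indep_sparse hF0.
  by rewrite -hc cardsT.
(* One configuration with all rows independent suffices: maximality makes [F0] everything, and [P]
   has already given its independence at [p]. *)
have [z hz] := sparse_generic_indep (n := #|E|) R (max_card _) hs.
have F0T : F0 = setT.
  by apply/eqP; rewrite eqEcard subsetT (hmax _ _ hz).
rewrite F0T in hF0; split.
  by apply: (rigid_of_indep v0 hu hp _ hF0); rewrite ?cardsT.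
(* Both edge sets of the lemma are [setT :\ e], so maximality is vacuous, and the rank is one short
   of [2n - 1]. *)
move=> e; apply: (not_rigid_of_maximal v0 hu hp (subxx _)) => [||z' f -> //].
  exact: indep_sub (subsetT _) hF0.
by rewrite -hE ltnS -cardsT (cardsD1 e [set: E]) in_setT; lia.
Qed.
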